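(* The reduction relation $\rightsquigarrow_{\beta\eta\kappa}$ on the set $\Lambda$ of typable modal $\lambda$-terms is strongly normalizing and confluent.
   Context: Types: $A ::= a \mid (A\to A) \mid \Box A$ ($a$ atoms). Modal $\lambda$-terms: $M,N ::= x \mid \lambda x.M \mid MN \mid M[N_1,\ldots,N_n/x_1,\ldots,x_n]$ (explicit substitution; $x_1,\ldots,x_n$ distinct and bound in $M$), modulo $\alpha$-equivalence and simultaneous permutation of the pairs $N_i/x_i$. Vectors $\vec P$ abbreviate lists. $FV(x)=\{x\}$, $FV(\lambda x.N)=FV(N)\setminus\{x\}$, $FV(NP)=FV(N)\cup FV(P)$, $FV(N[\vec P/\vec x])=\bigcup_i FV(P_i)$; $M\{N/x\}$ is capture-avoiding substitution. System $\mathsf{ND}_{\mathsf{CK}}$ (contexts = lists of declarations $x:A$ with distinct variables): (Id) $x_1:A_1,\ldots,x_n:A_n\vdash x_i:A_i$; (Abs) from $\Gamma,x:A\vdash M:C$ infer $\Gamma\vdash\lambda x.M:A\to C$; (App) from $\Gamma\vdash N:A$ and $\Gamma\vdash M:A\to C$ infer $\Gamma\vdash MN:C$; ($\Box$-subst) from $\Gamma\vdash N_i:\Box A_i$ ($i=1..n$) and $x_1:A_1,\ldots,x_n:A_n\vdash M:C$ infer $\Gamma\vdash M[N_1,\ldots,N_n/x_1,\ldots,x_n]:\Box C$, $x_i$ not in $\Gamma$. $\Lambda$: terms with a derivable type assignment; $\Lambda^\lambda$, $\Lambda^\Box$: its $\lambda$-abstractions, explicit substitutions. Ground steps: ($\beta_1$)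 $(\lambda x.M)N \to M\{N/x\}$; ($\beta_2$) $M[\vec P, R[\vec N/\vec z], \vec Q/\vec x, y, \vec w] \to (M\{R/y\})[\vec P,\vec N,\vec Q/\vec x,\vec z,\vec w]$; ($\eta_1$) $M\to \lambda x.Mx$ if $\Gamma\vdash M:A\to B$ derivable, $x\notin FV(M)$, $M\notin\Lambda^\lambda$; ($\eta_2$) $M\to x[M/x]$ if $\Gamma\vdash M:\Box A$ derivable, $x\notin FV(M)$, $M\notin\Lambda^\Box$; ($\kappa_1$) $M[\vec P,N,\vec Q/\vec x,y,\vec z]\to M[\vec P,\vec Q/\vec x,\vec z]$ if $y$ has no free occurrence in $M$; ($\kappa_2$) $M[\vec P,N,N,\vec Q/\vec x,y_1,y_2,\vec z]\to (M\{v,v/y_1,y_2\})[\vec P,N,\vec Q/\vec x,v,\vec z]$, $v$ fresh. Terms with a hole: $\mathsf C ::= \circ \mid \lambda x.\mathsf C \mid M\mathsf C \mid \mathsf C M \mid \mathsf C[\vec M/\vec x] \mid M[\vec N_1,\mathsf C,\vec N_2/\vec x_1,x,\vec x_2]$; $\mathsf E ::= \circ \mid \lambda x.\mathsf E \mid M\mathsf E \mid \mathsf E' M \mid \mathsf E[\vec M/\vec x] \mid M[\vec N_1,\mathsf E,\vec N_2/\vec x_1,x,\vec x_2]$ with $\mathsf E'\neq\circ$; $\mathsf D ::= \circ \mid \lambda x.\mathsf D \mid M\mathsf D \mid \mathsf D M \mid \mathsf D[\vec M/\vec x] \mid M[\vec N_1,\mathsf D',\vec N_2/\vec x_1,x,\vec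 x_2]$ with $\mathsf D'\neq\circ$. $\mathsf C\langle M\rangle\rightsquigarrow_\beta\mathsf C\langle N\rangle$ (resp. $\rightsquigarrow_\kappa$) for every $\mathsf C$ if $M\to N$ by $\beta_1,\beta_2$ (resp. $\kappa_1,\kappa_2$); $\mathsf E\langle M\rangle\rightsquigarrow_\eta\mathsf E\langle N\rangle$ if $M\to N$ by $\eta_1$; $\mathsf D\langle M\rangle\rightsquigarrow_\eta\mathsf D\langle N\rangle$ if $M\to N$ by $\eta_2$. $\rightsquigarrow_{\beta\eta\kappa}=\rightsquigarrow_\beta\cup\rightsquigarrow_\eta\cup\rightsquigarrow_\kappa$. Strongly normalizing: no infinite reduction sequence.
   Formalization: λ-abstractions carry the type of their variable, reduction is relative to a fixed context Γ, and the typing conditions of η1, η2 refer to the type of M at its position (κ2 compares annotated terms); read literally, x ⇝ λy.xy and x ⇝ y[x/y] are not joinable. *)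

(* Defs.v *)
From Stdlib Require Import Arith List Relations.
Import ListNotations.

Inductive ty : Type :=
| Atom (a : nat)
| Arr (A B : ty)
| Box (A : ty).

(* De Bruijn terms, so that alpha-equivalence is equality.  [Esub M [N1; ...; Nn]]
   is M[N1,...,Nn/x1,...,xn]: inside M the index i stands for x_(i+1).  The body M
   lives in a scope of its own: an outer variable cannot be mentioned in it,
   which is why FV, renaming and substitution do not visit M.
   Abstractions carry the type of their variable (Church style).  The conditions
   of eta1 and eta2 speak about the type of a subterm; without the annotation a
   term such as (\x.y)(\z.z) has no determined type for its subterms, and could be
   eta-expanded for ever by choosing a larger type for z at each step. *)
Inductive term : Type :=
| Var (i : nat)
| Abs (A : ty) (M : term)
| App (M N : term)
| Esub (M : term) (Ns : list term).

Fixpoint FV (M : term) : list nat :=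
  match M with
  | Var i => [i]
  | Abs _ N => map pred (remove Nat.eq_dec 0 (FV N))
  | App N P => FV N ++ FV P
  | Esub _ Ps => flat_map FV Ps
  end.

Definition up_ren (f : nat -> nat) (i : nat) : nat :=
  match i with 0 => 0 | S j => S (f j) end.

Fixpoint rename (f : nat -> nat) (M : term) : term :=
  match M with
  | Var i => Var (f i)
  | Abs A N => Abs A (rename (up_ren f) N)
  | App N P => App (rename f N) (rename f P)
  | Esub N Ps => Esub N (map (rename f) Ps)
  end.

Definition up (s : nat -> term) (i : nat) : term :=
  match i with 0 => Var 0 | S j => rename S (s j) end.

Fixpoint subst (s : nat -> term) (M : term) : term :=
  match M with
  | Var i => s i
  | Abs A N => Abs A (subst (up s) N)
  | App N P => App (subst s N) (subst s P)
  | Esub N Ps => Esub N (map (subst s) Ps)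
  end.

Definition ctx : Type := list ty.

Inductive typing : ctx -> term -> ty -> Prop :=
| T_Id G i A :
    nth_error G i = Some A -> typing G (Var i) A
| T_Abs G A M C :
    typing (A :: G) M C -> typing G (Abs A M) (Arr A C)
| T_App G M N A C :
    typing G N A -> typing G M (Arr A C) -> typing G (App M N) C
| T_BoxSubst G M Ns As C :
    Forall2 (fun N A => typing G N (Box A)) Ns As ->
    typing As M C -> typing G (Esub M Ns) (Box C).

(* Filling the hole may capture variables. *)
Inductive hterm : Type :=
| Hole
| HAbs (A : ty) (C : hterm)
| HAppR (M : term) (C : hterm)
| HAppL (C : hterm) (M : term)
| HBody (C : hterm) (Ms : list term)
| HArg (M : term) (Ns1 : list term) (C : hterm) (Ns2 : list term).

Fixpoint fill (C : hterm) (P : term) : term :=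
  match C with
  | Hole => P
  | HAbs A C => Abs A (fill C P)
  | HAppR M C => App M (fill C P)
  | HAppL C M => App (fill C P) M
  | HBody C Ms => Esub (fill C P) Ms
  | HArg M Ns1 C Ns2 => Esub M (Ns1 ++ fill C P :: Ns2)
  end.

Inductive Eterm : hterm -> Prop :=
| E_Hole : Eterm Hole
| E_Abs A E : Eterm E -> Eterm (HAbs A E)
| E_AppR M E : Eterm E -> Eterm (HAppR M E)
| E_AppL E M : Eterm E -> E <> Hole -> Eterm (HAppL E M)
| E_Body E Ms : Eterm E -> Eterm (HBody E Ms)
| E_Arg M Ns1 E Ns2 : Eterm E -> Eterm (HArg M Ns1 E Ns2).

Inductive Dterm : hterm -> Prop :=
| D_Hole : Dterm Hole
| D_Abs A D : Dterm D -> Dterm (HAbs A D)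
| D_AppR M D : Dterm D -> Dterm (HAppR M D)
| D_AppL D M : Dterm D -> Dterm (HAppL D M)
| D_Body D Ms : Dterm D -> Dterm (HBody D Ms)
| D_Arg M Ns1 D Ns2 : Dterm D -> D <> Hole -> Dterm (HArg M Ns1 D Ns2).

(* [hole_ctx G C D]: in a term C<P> typed in G, the subterm P is typed in D. *)
Inductive hole_ctx : ctx -> hterm -> ctx -> Prop :=
| HC_Hole G : hole_ctx G Hole G
| HC_Abs G A C D : hole_ctx (A :: G) C D -> hole_ctx G (HAbs A C) D
| HC_AppR G M C D : hole_ctx G C D -> hole_ctx G (HAppR M C) D
| HC_AppL G C M D : hole_ctx G C D -> hole_ctx G (HAppL C M) D
| HC_Body G C Ms As D :
    Forall2 (fun M A => typing G M (Box A)) Ms As ->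
    hole_ctx As C D -> hole_ctx G (HBody C Ms) D
| HC_Arg G M Ns1 C Ns2 D :
    hole_ctx G C D -> hole_ctx G (HArg M Ns1 C Ns2) D.

(* The pair with index i in the left-hand side has index [f i] in the
   right-hand side. *)
Inductive permute_pairs : term -> term -> Prop :=
| Permute_pairs f M Ns Ns' :
    length Ns' = length Ns ->
    (forall i, i < length Ns -> f i < length Ns) ->
    (forall i j, i < length Ns -> j < length Ns -> f i = f j -> i = j) ->
    (forall i, length Ns <= i -> f i = i) ->
    (forall i, i < length Ns -> nth_error Ns' (f i) = nth_error Ns i) ->
    permute_pairs (Esub M Ns) (Esub (rename f M) Ns').

Inductive closure (Ctx : hterm -> Prop) (R : relation term) : relation term :=
| Closure C M N : Ctx C -> R M N -> closure Ctx R (fill C M) (fill C N).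

Definition any_hterm (_ : hterm) : Prop := True.

(* The equality of terms: permutation of the pairs, anywhere in a term. *)
Definition teq : relation term :=
  clos_refl_sym_trans term (closure any_hterm permute_pairs).

Definition subst1 (N : term) (i : nat) : term :=
  match i with 0 => N | S j => Var j end.

(* M{R/y}, where y has index p among the p + 1 + q variables of M, and is
   replaced in their list by the n variables of R. *)
Definition splice (p n : nat) (R : term) (i : nat) : term :=
  if i <? p then Var i
  else if i =? p then rename (Nat.add p) R
  else Var (pred i + n).

Inductive beta : relation term :=
| beta1 A M N :
    beta (App (Abs A M) N) (subst (subst1 N) M)
| beta2 M Ps R Ns Qs :
    beta (Esub M (Ps ++ Esub R Ns :: Qs))
         (Esub (subst (splice (length Ps) (length Ns) R) M) (Ps ++ Ns ++ Qs)).

Definition is_abs (M : term) : Prop := exists A N, M = Abs A N.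
Definition is_esub (M : term) : Prop := exists N Ps, M = Esub N Ps.

Inductive eta1 (G : ctx) : relation term :=
| Eta1 M A B :
    typing G M (Arr A B) -> ~ is_abs M ->
    eta1 G M (Abs A (App (rename S M) (Var 0))).

Inductive eta2 (G : ctx) : relation term :=
| Eta2 M A :
    typing G M (Box A) -> ~ is_esub M ->
    eta2 G M (Esub (Var 0) [M]).

(* Deletes index p if p does not occur, identifies p and p + 1 otherwise;
   the two uses are kappa1 and kappa2. *)
Definition lower (p i : nat) : nat := if i <=? p then i else pred i.

Inductive kappa : relation term :=
| kappa1 M Ps N Qs :
    ~ In (length Ps) (FV M) ->
    kappa (Esub M (Ps ++ N :: Qs))
          (Esub (rename (lower (length Ps)) M) (Ps ++ Qs))
| kappa2 M Ps N Qs :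
    kappa (Esub M (Ps ++ N :: N :: Qs))
          (Esub (rename (lower (length Ps)) M) (Ps ++ N :: Qs)).

Definition red_beta : relation term := closure any_hterm beta.

Definition red_kappa : relation term := closure any_hterm kappa.

Inductive red_eta (G : ctx) : relation term :=
| Red_eta1 E D M N :
    Eterm E -> hole_ctx G E D -> eta1 D M N -> red_eta G (fill E M) (fill E N)
| Red_eta2 E D M N :
    Dterm E -> hole_ctx G E D -> eta2 D M N -> red_eta G (fill E M) (fill E N).

Definition red (G : ctx) (M N : term) : Prop :=
  red_beta M N \/ red_eta G M N \/ red_kappa M N.

(* The typable terms whose free variables are declared in G; as a set of terms
   modulo permutation it is the quotient of this type by [Lambda_eq]. *)
Definition Lambda (G : ctx) : Type := {M : term | exists A, typing G M A}.

Definition Lambda_eq (G : ctx) : relation (Lambda G) :=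
  fun M N => teq (proj1_sig M) (proj1_sig N).

Definition Lambda_red (G : ctx) : relation (Lambda G) :=
  fun M N => exists M' N',
    teq (proj1_sig M) M' /\ red G M' N' /\ teq N' (proj1_sig N).

Definition strongly_normalizing {X : Type} (R : relation X) : Prop :=
  ~ exists f : nat -> X, forall n, R (f n) (f (S n)).

(* Confluence of the relation induced by R on the quotient of X by Eq. *)
Definition confluent_modulo {X : Type} (Eq R : relation X) : Prop :=
  let Rstar := clos_refl_trans X (union X Eq R) in
  forall x y z, Rstar x y -> Rstar x z -> exists w, Rstar y w /\ Rstar z w.

(* Main.v *)
(** Strong normalization: terms are interpreted by monotone functionals that carry
    a cost, and every reduction step strictly lowers the cost.  The value of
    [Box A] is a cost together with a value of [A]; an explicit substitution adds
    up the costs of its arguments, which is insensitive to permutations and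
    drops under kappa steps.  Expansions decrease the cost because each place
    where a term of type [A] may be expanded is charged in advance by a functional
    defined by recursion on [A]; beta steps never create an uncharged place.

    Confluence: by strong normalization it suffices that convertible normal forms
    are equal up to permutations.  All steps are equalities in the full
    set-theoretic model where [Box A] is interpreted as [A]; normalization by
    evaluation into terms with formal box and unbox operators is the identity, up
    to that notation, on normal forms, and the notation determines a normal form
    up to permutations.

    Both arguments are instances of the same soundness theorem for ordered
    models: the second model takes equality as its order. *)

From Stdlib Require Import Arith List Relations Lia Permutation FinFun.
From Stdlib Require Import Classical ClassicalEpsilon FunctionalExtensionality.
From Stdlib Require Import Eqdep_dec.
Require Import Defs.
Import ListNotations.

(** The obstacle is the interplay of expansion with substitution. A beta step copies an argument to
    every place of a variable, possibly from a place that admits no expansion to places that do, so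
    counting expandable places gives no decreasing measure. Hence the charge acts on values: an
    argument is charged before it is passed, a variable is charged again where it is used, and at a
    function or box type [charge] is, up to one unit, the value of the expanded term itself. It thus
    pays for one expansion and for all those that this expansion opens at smaller types. An
    application also adds the cost of its argument, so that a beta step which erases the argument is
    still a strict decrease. Local confluence is not examined: the side conditions of the expansions
    are not stable under substitution, since a variable may be expanded while an abstraction put in
    its place may not. What has to be shown instead is that reading back forgets nothing but the
    order of the pairs. Normality for kappa gives this: every bound variable occurs in the body and
    no two arguments coincide, so the pairs can be recovered from the image of the body. *)

Lemma term_nested_ind (P : term -> Prop) :
  (forall i, P (Var i)) ->
  (forall A M, P M -> P (Abs A M)) ->
  (forall M N, P M -> P N -> P (App M N)) ->
  (forall M Ns, P M -> Forall P Ns -> P (Esub M Ns)) ->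
  forall M, P M.
Proof.
  intros HV HA HP HE. fix IH 1. intros [i|A M|M N|M Ns].
  - apply HV.
  - apply HA, IH.
  - apply HP; apply IH.
  - apply HE; [apply IH|].
    induction Ns as [|N Ns IHN]; constructor; [apply IH|apply IHN].
Qed.

(** * Lists and free variables *)

Lemma Forall2_nth_error_l {X Y} (P : X -> Y -> Prop) l l' i x :
  Forall2 P l l' -> nth_error l i = Some x ->
  exists y, nth_error l' i = Some y /\ P x y.
Proof.
  intros H; revert i; induction H as [|a b l l' Hab H IH]; intros [|i] Hi;
    simpl in *; try discriminate.
  - injection Hi as <-. eauto.
  - auto.
Qed.

Lemma Forall2_nth_error_r {X Y} (P : X -> Y -> Prop) l l' i y :
  Forall2 P l l' -> nth_error l' i = Some y ->
  exists x, nth_error l i = Some x /\ P x y.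
Proof.
  intros H; revert i; induction H as [|a b l l' Hab H IH]; intros [|i] Hi;
    simpl in *; try discriminate.
  - injection Hi as <-. eauto.
  - auto.
Qed.

Lemma Forall2_of_nth_error {X Y} (P : X -> Y -> Prop) l l' :
  length l = length l' ->
  (forall i x y, nth_error l i = Some x -> nth_error l' i = Some y -> P x y) ->
  Forall2 P l l'.
Proof.
  revert l'; induction l as [|a l IH]; intros [|b l'] Hl H; try discriminate;
    constructor.
  - apply (H 0); reflexivity.
  - apply IH; [now injection Hl|]. intros i; apply (H (S i)).
Qed.

Lemma nth_error_lt {X} (l : list X) i : i < length l -> exists x, nth_error l i = Some x.
Proof.
  intros H. destruct (nth_error l i) eqn:E; eauto.
  apply nth_error_None in E. lia.
Qed.

Lemma nth_error_some_lt {X} (l : list X) i x : nth_error l i = Some x -> i < length l.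
Proof. intros H. apply nth_error_Some. congruence. Qed.

Lemma in_FV_Abs A M i : In i (FV (Abs A M)) <-> In (S i) (FV M).
Proof.
  simpl. rewrite in_map_iff. split.
  - intros (j & <- & Hj). apply in_remove in Hj as [Hj H0].
    destruct j; simpl; [congruence|assumption].
  - intros H. exists (S i). split; [reflexivity|]. apply in_in_remove; auto.
Qed.

Lemma in_FV_Esub M Ns i : In i (FV (Esub M Ns)) <-> exists N, In N Ns /\ In i (FV N).
Proof. simpl. apply in_flat_map. Qed.

(** * Typing *)

(** The annotations on abstractions make types synthesizable. This identifies the type mentioned by
    an expansion, or the context reached by a hole, with the one in the ambient derivation. *)
Lemma typing_unique M : forall G A B, typing G M A -> typing G M B -> A = B.
Proof.
  induction M as [i|A0 M IH|M N IHM IHN|M Ns IHM IHNs] using term_nested_ind;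
    intros G A B HA HB; inversion HA; inversion HB; subst.
  - congruence.
  - f_equal; eauto.
  - match goal with H1 : typing G M _, H2 : typing G M _ |- _ =>
      pose proof (IHM _ _ _ H1 H2) end. congruence.
  - f_equal. enough (As = As0) by (subst; eauto).
    match goal with H1 : Forall2 _ Ns ?Xs, H2 : Forall2 _ Ns ?Ys |- _ =>
      revert H1 H2; clear -IHNs end.
    revert As As0; induction IHNs as [|N Ns HN _ IH]; intros As Bs H1 H2;
      inversion H1; inversion H2; subst; f_equal; auto.
    match goal with H1 : typing G N _, H2 : typing G N _ |- _ =>
      pose proof (HN _ _ _ H1 H2) end. congruence.
Qed.

(** The condition on [f] is limited to free variables because a [kappa1] step gives the deleted
    variable no proper image. *)
Lemma typing_rename M : forall G G' f A,
  typing G M A ->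
  (forall i B, In i (FV M) -> nth_error G i = Some B -> nth_error G' (f i) = Some B) ->
  typing G' (rename f M) A.
Proof.
  induction M as [i|A0 M IH|M N IHM IHN|M Ns IHM IHNs] using term_nested_ind;
    intros G G' f A HA Hf; inversion HA; subst; simpl.
  - constructor. apply Hf; simpl; auto.
  - constructor. eapply IH; [eassumption|].
    intros [|i] B Hi HB; simpl in *; [assumption|].
    apply Hf; [now apply in_FV_Abs|assumption].
  - econstructor; [eapply IHN|eapply IHM]; eauto;
      intros; apply Hf; simpl; auto using in_or_app.
  - econstructor; [|eassumption].
    assert (Hf' : forall N i B, In N Ns -> In i (FV N) -> nth_error G i = Some B ->
              nth_error G' (f i) = Some B).
    { intros N i B HN Hi. apply Hf. apply in_FV_Esub. eauto. }
    match goal with H : Forall2 _ Ns As |- _ => revert H end.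
    clear -IHNs Hf'. revert As.
    induction IHNs as [|N Ns HN _ IH]; intros As H; inversion H; subst;
      constructor.
    + eapply HN; eauto. intros; eapply Hf'; simpl; eauto.
    + apply IH; auto. intros; eapply Hf'; simpl; eauto.
Qed.

Lemma typing_rename_S G A B M : typing G M A -> typing (B :: G) (rename S M) A.
Proof. intros H. eapply typing_rename; [eassumption|]. auto. Qed.

Lemma typing_subst M : forall G G' s A,
  typing G M A ->
  (forall i B, nth_error G i = Some B -> typing G' (s i) B) ->
  typing G' (subst s M) A.
Proof.
  induction M as [i|A0 M IH|M N IHM IHN|M Ns IHM IHNs] using term_nested_ind;
    intros G G' s A HA Hs; inversion HA; subst; simpl.
  - auto.
  - constructor. eapply IH; [eassumption|].
    intros [|i] B HB; simpl in *; [now constructor|].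
    apply typing_rename_S; auto.
  - econstructor; eauto.
  - econstructor; [|eassumption].
    match goal with H : Forall2 _ Ns As |- _ => revert H end.
    clear -IHNs Hs. revert As.
    induction IHNs as [|N Ns HN _ IH]; intros As H; inversion H; subst;
      constructor; eauto.
Qed.

Definition unbox_ty (A : ty) : ty := match A with Box B => B | _ => A end.

(** Total, with arbitrary answers on untypable terms, so that values can be assigned by recursion on
    raw terms rather than on derivations. *)
Fixpoint tyof (M : term) (G : ctx) : ty :=
  match M with
  | Var i => nth i G (Atom 0)
  | Abs A M => Arr A (tyof M (A :: G))
  | App M N => match tyof M G with Arr _ B => B | A => A end
  | Esub M Ns => Box (tyof M (map (fun N => unbox_ty (tyof N G)) Ns))
  end.

Lemma tyof_typing M : forall G A, typing G M A -> tyof M G = A.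
Proof.
  induction M as [i|A0 M IH|M N IHM IHN|M Ns IHM IHNs] using term_nested_ind;
    intros G A HA; inversion HA; subst; simpl.
  - now apply nth_error_nth.
  - f_equal; auto.
  - match goal with H1 : typing G M _ |- _ => rewrite (IHM _ _ H1) end. reflexivity.
  - f_equal. apply IHM.
    enough (map (fun N => unbox_ty (tyof N G)) Ns = As) as -> by assumption.
    match goal with H : Forall2 _ Ns As |- _ => revert H end. clear -IHNs.
    revert As; induction IHNs as [|N Ns HN _ IH]; intros As H;
      inversion H; subst; simpl; f_equal; auto.
    erewrite HN by eassumption. reflexivity.
Qed.

Lemma map_tyof_typing G Ns As :
  Forall2 (fun N A => typing G N (Box A)) Ns As ->
  map (fun N => unbox_ty (tyof N G)) Ns = As.
Proof.
  induction 1 as [|N A Ns As HN _ IH]; simpl; f_equal; auto.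
  erewrite tyof_typing by eassumption. reflexivity.
Qed.

Lemma box_types_unique G Ns As Bs :
  Forall2 (fun N A => typing G N (Box A)) Ns As ->
  Forall2 (fun N A => typing G N (Box A)) Ns Bs -> As = Bs.
Proof.
  intros HA HB. apply map_tyof_typing in HA, HB. congruence.
Qed.

(** * Reduction relations by structural rules *)

(* The boolean is [false] at the places where an expansion of the whole term
   is forbidden: functions of applications and arguments of explicit
   substitutions. *)
Inductive cstep (R : bool -> ctx -> relation term) : bool -> ctx -> relation term :=
| cs_root b G M N : R b G M N -> cstep R b G M N
| cs_abs b G A M N :
    cstep R true (A :: G) M N -> cstep R b G (Abs A M) (Abs A N)
| cs_appl b G M M' N :
    cstep R false G M M' -> cstep R b G (App M N) (App M' N)
| cs_appr b G M N N' :
    cstep R true G N N' -> cstep R b G (App M N) (App M N')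
| cs_body b G M M' Ns As :
    Forall2 (fun N A => typing G N (Box A)) Ns As ->
    cstep R true As M M' -> cstep R b G (Esub M Ns) (Esub M' Ns)
| cs_arg b G M Ns1 N N' Ns2 :
    cstep R false G N N' ->
    cstep R b G (Esub M (Ns1 ++ N :: Ns2)) (Esub M (Ns1 ++ N' :: Ns2)).

Inductive root_red : bool -> ctx -> relation term :=
| rr_beta b G M N : beta M N -> root_red b G M N
| rr_kappa b G M N : kappa M N -> root_red b G M N
| rr_eta1 G M N : eta1 G M N -> root_red true G M N
| rr_eta2 G M N : eta2 G M N -> root_red true G M N.

Definition root_perm (b : bool) (G : ctx) : relation term := permute_pairs.

Definition preserves_typing (R : bool -> ctx -> relation term) : Prop :=
  forall b G M N A, R b G M N -> typing G M A -> typing G N A.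

Lemma cstep_typing R : preserves_typing R -> preserves_typing (cstep R).
Proof.
  intros HR b G M N A H. revert A.
  induction H; intros T HT.
  - eapply HR; eassumption.
  - inversion HT; subst. constructor; auto.
  - inversion HT; subst. econstructor; eauto.
  - inversion HT; subst. econstructor; eauto.
  - inversion HT; subst.
    match goal with H1 : Forall2 _ Ns ?Xs, H2 : Forall2 _ Ns ?Ys |- _ =>
      pose proof (box_types_unique _ _ _ _ H1 H2); subst Ys end. econstructor; eauto.
  - inversion HT; subst.
    econstructor; [|eassumption].
    match goal with H1 : Forall2 _ (_ ++ _) _ |- _ =>
        apply Forall2_app_inv_l in H1 as (As1 & As2 & H1 & H2 & ->) end.
    inversion H2; subst. apply Forall2_app; auto.
Qed.

Lemma closure_cstep (R0 : relation term) (R : bool -> ctx -> relation term) :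
  (forall b G M N, R0 M N -> R b G M N) ->
  forall b G M N A, closure any_hterm R0 M N -> typing G M A -> cstep R b G M N.
Proof.
  intros HR b G M N A [C P Q _ H] HT. revert b G A HT.
  induction C; simpl; intros b G T HT.
  - apply cs_root; auto.
  - inversion HT; subst. apply cs_abs; eauto.
  - inversion HT; subst. eapply cs_appr; eauto.
  - inversion HT; subst. eapply cs_appl; eauto.
  - inversion HT; subst. eapply cs_body; eauto.
  - inversion HT; subst. eapply cs_arg.
    match goal with H1 : Forall2 _ (_ ++ _) _ |- _ =>
        apply Forall2_app_inv_l in H1 as (As1 & As2 & H1 & H2 & ->) end.
    inversion H2; subst; eauto.
Qed.

(** The two grammars forbid different places, yet one flag covers both: a function position has an
    arrow type, which already excludes [eta2], and an argument of an explicit substitution has a box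
    type, which already excludes [eta1]. *)
Lemma red_eta_cstep G M N A :
  typing G M A -> red_eta G M N -> cstep root_red true G M N.
Proof.
  intros HT H; revert HT; destruct H as [E D P Q HE HC He|E D P Q HE HC He]; intros HT.
  (* At flag false the hole is either deeper, or it sits at an argument of box type, where [eta1] is
     ill-typed. *)
  - enough (forall b, (b = false -> exists T, typing G (fill E P) (Box T) \/ E <> Hole) ->
              cstep root_red b G (fill E P) (fill E Q)) as H
      by (apply H; discriminate).
    revert A HT. induction HC; inversion HE; subst; simpl; intros T HT b Hb.
    + destruct b; [now apply cs_root, rr_eta1|].
      destruct (Hb eq_refl) as (T' & [H|H]); [|congruence]. inversion He; subst.
      match goal with H1 : typing G P _, H2 : typing G P (_ _) |- _ =>
        pose proof (typing_unique _ _ _ _ H1 H2); discriminate end.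
    + inversion HT; subst. apply cs_abs. eapply IHHC; eauto. discriminate.
    + inversion HT; subst. apply cs_appr. eapply IHHC; eauto. discriminate.
    + inversion HT; subst. apply cs_appl. eapply IHHC; [assumption|assumption|eassumption|].
      intros _; exists (Atom 0); auto.
    + inversion HT; subst.
      match goal with H1 : Forall2 _ Ms ?Xs, H2 : Forall2 _ Ms ?Ys |- _ =>
      pose proof (box_types_unique _ _ _ _ H1 H2); subst Ys end.
      eapply cs_body; [eassumption|]. eapply IHHC; eauto. discriminate.
    + inversion HT; subst. apply cs_arg.
      match goal with H1 : Forall2 _ (_ ++ _) _ |- _ =>
        apply Forall2_app_inv_l in H1 as (As1 & As2 & H1 & H2 & ->) end.
      inversion H2; subst. eapply IHHC; eauto.
  - enough (forall b, (b = false -> exists T T', typing G (fill E P) (Arr T T') \/ E <> Hole) ->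
              cstep root_red b G (fill E P) (fill E Q)) as H
      by (apply H; discriminate).
    revert A HT. induction HC; inversion HE; subst; simpl; intros T HT b Hb.
    + destruct b; [now apply cs_root, rr_eta2|].
      destruct (Hb eq_refl) as (T' & T'' & [H|H]); [|congruence]. inversion He; subst.
      match goal with H1 : typing G P _, H2 : typing G P (_ _) |- _ =>
        pose proof (typing_unique _ _ _ _ H1 H2); discriminate end.
    + inversion HT; subst. apply cs_abs. eapply IHHC; eauto. discriminate.
    + inversion HT; subst. apply cs_appr. eapply IHHC; eauto. discriminate.
    + inversion HT; subst. apply cs_appl. eapply IHHC; eauto.
    + inversion HT; subst.
      match goal with H1 : Forall2 _ Ms ?Xs, H2 : Forall2 _ Ms ?Ys |- _ =>
      pose proof (box_types_unique _ _ _ _ H1 H2); subst Ys end.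
      eapply cs_body; [eassumption|]. eapply IHHC; eauto. discriminate.
    + inversion HT; subst. apply cs_arg.
      match goal with H1 : Forall2 _ (_ ++ _) _ |- _ =>
        apply Forall2_app_inv_l in H1 as (As1 & As2 & H1 & H2 & ->) end.
      inversion H2; subst. eapply IHHC; [assumption|assumption|eassumption|].
      intros _; exists (Atom 0), (Atom 0); auto.
Qed.

Lemma red_cstep G M N A :
  typing G M A -> red G M N -> cstep root_red true G M N.
Proof.
  intros HT [H|[H|H]].
  - eapply closure_cstep; eauto. intros; now apply rr_beta.
  - eapply red_eta_cstep; eassumption.
  - eapply closure_cstep; eauto. intros; now apply rr_kappa.
Qed.

(** The clause [E <> Hole] at flag false is what the induction needs in order to rebuild [Eterm] and
    [Dterm] at their two restricted positions. *)
Definition ctx_red (b : bool) (G : ctx) (M N : term) : Prop :=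
  (exists C P Q, (beta P Q \/ kappa P Q) /\ M = fill C P /\ N = fill C Q) \/
  (exists E D P Q, (b = false -> E <> Hole) /\ hole_ctx G E D /\
     (Eterm E /\ eta1 D P Q \/ Dterm E /\ eta2 D P Q) /\
     M = fill E P /\ N = fill E Q).

Lemma cstep_ctx_red b G M N : cstep root_red b G M N -> ctx_red b G M N.
Proof.
  induction 1 as [b G M N H|b G A M N _ IH|b G M M' N _ IH|b G M N N' _ IH
                 |b G M M' Ns As HNs _ IH|b G M Ns1 N N' Ns2 _ IH].
  - destruct H.
    + left; exists Hole, M, N; auto.
    + left; exists Hole, M, N; auto.
    + right; exists Hole, G, M, N. split; [discriminate|]. split; [apply HC_Hole|].
      split; [left; split; [apply E_Hole|assumption]|auto].
    + right; exists Hole, G, M, N. split; [discriminate|]. split; [apply HC_Hole|].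
      split; [right; split; [apply D_Hole|assumption]|auto].
  - destruct IH as [(C & P & Q & H & -> & ->)|(E & D & P & Q & Hb & HC & H & -> & ->)].
    + left; exists (HAbs A C), P, Q; auto.
    + right; exists (HAbs A E), D, P, Q; repeat split; try discriminate;
        [now constructor|]. destruct H as [[]|[]]; [left|right]; split; auto; now constructor.
  - destruct IH as [(C & P & Q & H & -> & ->)|(E & D & P & Q & Hb & HC & H & -> & ->)].
    + left; exists (HAppL C N), P, Q; auto.
    + right; exists (HAppL E N), D, P, Q; repeat split; try discriminate;
        [now constructor|]. destruct H as [[]|[]]; [left|right]; split; auto;
        constructor; auto.
  - destruct IH as [(C & P & Q & H & -> & ->)|(E & D & P & Q & Hb & HC & H & -> & ->)].
    + left; exists (HAppR M C), P, Q; auto.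
    + right; exists (HAppR M E), D, P, Q; repeat split; try discriminate;
        [now constructor|]. destruct H as [[]|[]]; [left|right]; split; auto; now constructor.
  - destruct IH as [(C & P & Q & H & -> & ->)|(E & D & P & Q & Hb & HC & H & -> & ->)].
    + left; exists (HBody C Ns), P, Q; auto.
    + right; exists (HBody E Ns), D, P, Q; repeat split; try discriminate;
        [econstructor; eassumption|].
      destruct H as [[]|[]]; [left|right]; split; auto; now constructor.
  - destruct IH as [(C & P & Q & H & -> & ->)|(E & D & P & Q & Hb & HC & H & -> & ->)].
    + left; exists (HArg M Ns1 C Ns2), P, Q; auto.
    + right; exists (HArg M Ns1 E Ns2), D, P, Q; repeat split; try discriminate;
        [now constructor|]. destruct H as [[]|[]]; [left|right]; split; auto;
        constructor; auto.
Qed.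

Lemma cstep_red G M N : cstep root_red true G M N -> red G M N.
Proof.
  intros H. apply cstep_ctx_red in H
    as [(C & P & Q & [H|H] & -> & ->)|(E & D & P & Q & _ & HC & [[HE H]|[HE H]] & -> & ->)].
  - left. now constructor.
  - right; right. now constructor.
  - right; left. eapply Red_eta1; eassumption.
  - right; left. eapply Red_eta2; eassumption.
Qed.

(** * Subject reduction *)

Lemma nth_error_app_cons {X} (l1 l2 : list X) x : nth_error (l1 ++ x :: l2) (length l1) = Some x.
Proof. rewrite nth_error_app2 by lia. now rewrite Nat.sub_diag. Qed.

Lemma root_red_typing : preserves_typing root_red.
Proof.
  intros b G M N A H HT. destruct H as [b G M N H|b G M N H|G M N H|G M N H].
  - destruct H as [A0 M N|M Ps R Ns Qs]; inversion HT; subst.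
    + match goal with H : typing G (Abs _ _) _ |- _ => inversion H; subst end.
      eapply typing_subst; [eassumption|].
      intros [|i] B HB; simpl in *; [congruence|now constructor].
    + match goal with H : Forall2 _ _ _ |- _ =>
        apply Forall2_app_inv_l in H as (As1 & As2 & HP & H2 & ->) end.
      inversion H2 as [|? A1 ? As3 HR HQ]; subst. inversion HR as [| | |? ? ? Bs ? HN HRt]; subst.
      pose proof (Forall2_length HP) as LP. pose proof (Forall2_length HN) as LN.
      apply T_BoxSubst with (As := As1 ++ Bs ++ As3);
        [apply Forall2_app; [assumption|apply Forall2_app; assumption]|].
      eapply typing_subst; [eassumption|].
      intros i B HB. unfold splice.
      destruct (Nat.ltb_spec i (length Ps)).
      * constructor. rewrite nth_error_app1 in HB |- * by lia. assumption.
      * rewrite nth_error_app2 in HB by lia.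
        destruct (Nat.eqb_spec i (length Ps)) as [->|].
        -- replace (length Ps - length As1) with 0 in HB by lia. injection HB as <-.
           eapply typing_rename; [eassumption|]. intros j C0 _ HC.
           apply nth_error_some_lt in HC as Lj.
           rewrite nth_error_app2 by lia. rewrite nth_error_app1 by lia.
           rewrite <- HC. f_equal; lia.
        -- constructor. rewrite !nth_error_app2 by lia.
           replace (i - length As1) with (S (pred i - length As1)) in HB by lia.
           simpl in HB. rewrite <- HB. f_equal; lia.
  - destruct H as [M Ps N Qs Hp|M Ps N Qs]; inversion HT; subst.
    + match goal with H : Forall2 _ _ _ |- _ =>
        apply Forall2_app_inv_l in H as (As1 & As2 & HP & H2 & ->) end.
      inversion H2 as [|? A1 ? As3 HN HQ]; subst.
      pose proof (Forall2_length HP) as LP.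
      apply T_BoxSubst with (As := As1 ++ As3); [now apply Forall2_app|].
      eapply typing_rename; [eassumption|].
      intros i B Hi HB. unfold lower. destruct (Nat.leb_spec i (length Ps)).
      * assert (i <> length Ps) by congruence.
        rewrite nth_error_app1 in HB |- * by lia. assumption.
      * rewrite nth_error_app2 in HB |- * by lia.
        replace (i - length As1) with (S (pred i - length As1)) in HB by lia.
        assumption.
    + match goal with H : Forall2 _ _ _ |- _ =>
        apply Forall2_app_inv_l in H as (As1 & As2 & HP & H2 & ->) end.
      inversion H2 as [|? A1 ? As3 HN H3]; subst.
      inversion H3 as [|? A2 ? As4 HN' HQ]; subst.
      (* Both copies of [N] have the same type, so the merged variable has a single declaration. *)
      pose proof (typing_unique _ _ _ _ HN HN') as E. injection E as <-.
      pose proof (Forall2_length HP) as LP.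
      apply T_BoxSubst with (As := As1 ++ A1 :: As4); [apply Forall2_app; auto|].
      eapply typing_rename; [eassumption|].
      intros i B _ HB. unfold lower. destruct (Nat.leb_spec i (length Ps)).
      * destruct (Nat.eq_dec i (length As1)) as [->|].
        -- rewrite nth_error_app_cons in *. assumption.
        -- rewrite nth_error_app1 in HB |- * by lia. assumption.
      * rewrite nth_error_app2 in HB |- * by lia.
        replace (i - length As1) with (S (pred i - length As1)) in HB by lia.
        simpl in HB. destruct (pred i - length As1); assumption.
  - destruct H as [M A1 B H _].
    pose proof (typing_unique _ _ _ _ H HT) as <-.
    constructor. econstructor; [|apply typing_rename_S; eassumption].
    now constructor.
  - destruct H as [M A1 H _].
    pose proof (typing_unique _ _ _ _ H HT) as <-.
    econstructor; [constructor; [eassumption|constructor]|now constructor].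
Qed.

(** * Permutations of pairs and equality of terms *)

Lemma rename_comp M : forall f g, rename g (rename f M) = rename (fun i => g (f i)) M.
Proof.
  induction M as [i|A0 M IH|M N IHM IHN|M Ns IHM IHNs] using term_nested_ind;
    intros f g; simpl; f_equal; auto.
  - rewrite IH. f_equal. apply functional_extensionality. now intros [|i].
  - rewrite map_map. apply map_ext_Forall.
    eapply Forall_impl; [|eassumption]. auto.
Qed.

Lemma rename_id M f : (forall i, f i = i) -> rename f M = M.
Proof.
  revert f; induction M as [i|A0 M IH|M N IHM IHN|M Ns IHM IHNs] using term_nested_ind;
    intros f Hf; simpl; f_equal; auto.
  - apply IH. intros [|i]; simpl; auto.
  - induction IHNs; simpl; f_equal; auto.
Qed.

(** By the pigeonhole principle an injection of a finite initial segment into itself is onto. Being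
    the identity elsewhere, [f] then has a two-sided inverse on all indices. *)
Lemma bounded_injection_inverse n f :
  (forall i, i < n -> f i < n) ->
  (forall i j, i < n -> j < n -> f i = f j -> i = j) ->
  (forall i, n <= i -> f i = i) ->
  exists g, (forall i, i < n -> g i < n) /\ (forall i, n <= i -> g i = i) /\
    (forall i, g (f i) = i) /\ (forall i, f (g i) = i).
Proof.
  intros H1 H2 H3.
  assert (HI : bInjective n f) by (intros i j Hi Hj; auto).
  apply bInjective_bSurjective in HI; [|exact H1].
  apply bSurjective_bBijective in HI as (g & Hg & Hgf); [|exact H1].
  exists (fun i => if i <? n then g i else i). repeat split.
  - intros i Hi. destruct (Nat.ltb_spec i n); [auto|lia].
  - intros i Hi. destruct (Nat.ltb_spec i n); [lia|auto].
  - intros i. destruct (Nat.ltb_spec (f i) n).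
    + destruct (Nat.lt_ge_cases i n); [now apply Hgf|].
      rewrite H3 in H by lia. lia.
    + destruct (Nat.lt_ge_cases i n) as [L|]; [|auto].
      specialize (H1 i L). lia.
  - intros i. destruct (Nat.ltb_spec i n); [now apply Hgf|auto].
Qed.

Lemma permute_pairs_inv M N :
  permute_pairs M N ->
  exists f g P Ns Ns', M = Esub P Ns /\ N = Esub (rename f P) Ns' /\
    length Ns' = length Ns /\
    (forall i, i < length Ns -> f i < length Ns) /\
    (forall i, i < length Ns -> g i < length Ns) /\
    (forall i, length Ns <= i -> f i = i) /\
    (forall i, length Ns <= i -> g i = i) /\
    (forall i, g (f i) = i) /\ (forall i, f (g i) = i) /\
    (forall i, nth_error Ns' (f i) = nth_error Ns i) /\
    (forall i, nth_error Ns (g i) = nth_error Ns' i).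
Proof.
  intros [f P Ns Ns' HL H1 H2 H3 H4].
  destruct (bounded_injection_inverse _ _ H1 H2 H3) as (g & G1 & G2 & G3 & G4).
  assert (H4' : forall i, nth_error Ns' (f i) = nth_error Ns i).
  { intros i. destruct (Nat.lt_ge_cases i (length Ns)) as [L|L]; [auto|].
    rewrite H3 by lia. transitivity (@None term); [|symmetry];
      apply nth_error_None; lia. }
  exists f, g, P, Ns, Ns'. repeat (split; [now auto|]).
  intros i. rewrite <- H4', G4. reflexivity.
Qed.

Lemma permute_pairs_sym M N : permute_pairs M N -> permute_pairs N M.
Proof.
  intros H. apply permute_pairs_inv in H
    as (f & g & P & Ns & Ns' & -> & -> & HL & Hf & Hg & Hf' & Hg' & Hgf & Hfg & _ & Hn').
  assert (E : Esub P Ns = Esub (rename g (rename f P)) Ns)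
    by (rewrite rename_comp, rename_id; auto).
  rewrite E. constructor; rewrite ?HL; auto.
  intros i j _ _ Hij. now rewrite <- (Hfg i), Hij, Hfg.
Qed.

Lemma root_perm_typing : preserves_typing root_perm.
Proof.
  intros b G M N A H HT. apply permute_pairs_inv in H
    as (f & g & P & Ns & Ns' & -> & -> & HL & Hf & Hg & Hf' & Hg' & Hgf & Hfg & Hn & Hn').
  inversion HT as [| | |? ? ? As C HNs HP]; subst.
  assert (HNs' : Forall2 (fun N A => typing G N (Box A)) Ns'
                   (map (fun N => unbox_ty (tyof N G)) Ns')).
  { apply Forall2_of_nth_error; [now rewrite length_map|].
    intros i N A Hi HA. rewrite nth_error_map, Hi in HA. injection HA as <-.
    rewrite <- Hn' in Hi. eapply Forall2_nth_error_l in Hi as (B & _ & HB); [|eassumption].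
    rewrite (tyof_typing _ _ _ HB). exact HB. }
  econstructor; [exact HNs'|]. eapply typing_rename; [eassumption|].
  intros i B _ HB. eapply Forall2_nth_error_r in HB as (N & Hi & HB); [|eassumption].
  rewrite nth_error_map, Hn, Hi. simpl. rewrite (tyof_typing _ _ _ HB). reflexivity.
Qed.

(** The generating relation is symmetric, so backward steps are forward steps, and later arguments
    need typing to be preserved in one direction only. *)
Lemma teq_clos_refl_trans M N :
  teq M N -> clos_refl_trans term (closure any_hterm permute_pairs) M N.
Proof.
  assert (HS : forall P Q, clos_refl_trans term (closure any_hterm permute_pairs) P Q ->
                 clos_refl_trans term (closure any_hterm permute_pairs) Q P).
  { intros P Q. induction 1 as [P Q [C P' Q' _ H]|P|P Q S _ IH1 _ IH2].
    - apply rt_step. constructor; [exact I|]. now apply permute_pairs_sym.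
    - apply rt_refl.
    - eapply rt_trans; eassumption. }
  induction 1 as [P Q H|P|P Q _ IH|P Q S _ IH1 _ IH2].
  - now apply rt_step.
  - apply rt_refl.
  - auto.
  - eapply rt_trans; eassumption.
Qed.

(** [teq] relates raw terms. Carrying the type along the chain lets each link be treated as a typed
    [cstep]. *)
Lemma teq_typed_ind (Q : ctx -> ty -> relation term) :
  (forall G A M, typing G M A -> Q G A M M) -> (forall G A, transitive _ (Q G A)) ->
  (forall G A M N, typing G M A -> typing G N A ->
     cstep root_perm true G M N -> Q G A M N) ->
  forall G A M N, teq M N -> typing G M A -> typing G N A /\ Q G A M N.
Proof.
  intros HR HTr HQ G A M N H. apply teq_clos_refl_trans in H.
  induction H as [P P' H|P|P Q1 S _ IH1 _ IH2]; intros HT.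
  - pose proof (closure_cstep _ root_perm (fun _ _ _ _ h => h) true _ _ _ _ H HT) as HS.
    pose proof (cstep_typing _ root_perm_typing _ _ _ _ _ HS HT). auto.
  - split; [assumption|now apply HR].
  - destruct (IH1 HT) as [T1 Q1']. destruct (IH2 T1) as [T2 Q2].
    split; [assumption|]. eapply HTr; eassumption.
Qed.

Lemma teq_typing G A M N : teq M N -> typing G M A -> typing G N A.
Proof.
  intros H HT.
  apply (teq_typed_ind (fun _ _ _ _ => True)) with (G := G) (A := A) in H;
    try (red; auto); tauto.
Qed.

Fixpoint hcomp (C1 C2 : hterm) : hterm :=
  match C1 with
  | Hole => C2
  | HAbs A C => HAbs A (hcomp C C2)
  | HAppR M C => HAppR M (hcomp C C2)
  | HAppL C M => HAppL (hcomp C C2) M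
  | HBody C Ms => HBody (hcomp C C2) Ms
  | HArg M Ns1 C Ns2 => HArg M Ns1 (hcomp C C2) Ns2
  end.

Lemma fill_hcomp C1 C2 P : fill (hcomp C1 C2) P = fill C1 (fill C2 P).
Proof. induction C1; simpl; congruence. Qed.

Lemma teq_fill C M N : teq M N -> teq (fill C M) (fill C N).
Proof.
  induction 1 as [M N [C2 P Q _ H]|M|M N _ IH|M N P _ IH1 _ IH2].
  - apply rst_step. rewrite <- !fill_hcomp. now constructor.
  - apply rst_refl.
  - now apply rst_sym.
  - eapply rst_trans; eassumption.
Qed.

Lemma teq_app M M' N N' : teq M M' -> teq N N' -> teq (App M N) (App M' N').
Proof.
  intros H1 H2. eapply rst_trans.
  - apply (teq_fill (HAppL Hole N) _ _ H1).
  - apply (teq_fill (HAppR M' Hole) _ _ H2).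
Qed.

Lemma teq_esub M M' Ns Ns' : teq M M' -> Forall2 teq Ns Ns' -> teq (Esub M Ns) (Esub M' Ns').
Proof.
  intros H1 H2. eapply rst_trans; [apply (teq_fill (HBody Hole Ns) _ _ H1)|]. simpl.
  change Ns with ([] ++ Ns). change Ns' with ([] ++ Ns').
  generalize (@nil term). induction H2 as [|N N' Ns Ns' HN _ IH]; intros L.
  - apply rst_refl.
  - eapply rst_trans; [apply (teq_fill (HArg M' L Hole Ns) _ _ HN)|]. simpl.
    change (N' :: Ns) with ([N'] ++ Ns). change (N' :: Ns') with ([N'] ++ Ns').
    rewrite !app_assoc. apply IH.
Qed.

Lemma permute_pairs_of_Permutation M Ns Ns' :
  Permutation Ns Ns' -> exists f, permute_pairs (Esub M Ns) (Esub (rename f M) Ns').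
Proof.
  intros H. pose proof (Permutation_length H) as HL.
  apply Permutation_sym, Permutation_nth_error_bis in H as (f & Hf1 & Hf2 & Hf3).
  (* The map taken from [Permutation] is unconstrained beyond the list, where [permute_pairs]
     demands the identity. *)
  exists (fun i => if i <? length Ns then f i else i).
  constructor; auto.
  - intros i Hi. destruct (Nat.ltb_spec i (length Ns)); [|lia]. rewrite HL in *. auto.
  - intros i j Hi Hj. destruct (Nat.ltb_spec i (length Ns)); [|lia].
    destruct (Nat.ltb_spec j (length Ns)); [|lia]. apply Hf1.
  - intros i Hi. destruct (Nat.ltb_spec i (length Ns)); lia.
  - intros i Hi. destruct (Nat.ltb_spec i (length Ns)); [|lia]. now rewrite Hf3.
Qed.

(** * Ordered models *)

(* [le] is a partial preorder: its domain [le x x] singles out the monotone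
   elements.  [charge A] is applied at the places where an expansion of type [A]
   is allowed; it is large enough to pay for the expansion.  In a model that is
   not [strict] the costs play no role, and [le] may be equality. *)
Record model := {
  carrier :> ty -> Type;
  le : forall A, relation (carrier A);
  cost : forall A, carrier A -> nat;
  strict : Prop;
  dflt : forall A, carrier A;
  charge : forall A, carrier A -> carrier A;
  lam : forall A B, (carrier A -> carrier B) -> carrier (Arr A B);
  app : forall A B, carrier (Arr A B) -> carrier A -> carrier B;
  esub : forall A, nat -> carrier A -> carrier (Box A);
  val : forall A, carrier (Box A) -> carrier A;
  ord := fun (w : bool) A (x y : carrier A) =>
    le A x y /\ (w = true -> strict -> cost A x < cost A y);
  le_refl_l : forall A x y, le A x y -> le A x x;
  le_refl_r : forall A x y, le A x y -> le A y y;
  le_trans : forall A, transitive _ (le A);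
  le_cost : forall A x y, le A x y -> cost A x <= cost A y;
  charge_ord : forall w A x y, ord w A x y -> ord w A (charge A x) (charge A y);
  charge_ge : forall A x, le A x x -> le A x (charge A x);
  app_ord : forall w w' A B p q x y, ord w (Arr A B) p q -> ord w' A x y ->
    ord (w || w') B (app A B p x) (app A B q y);
  lam_ord : forall w A B f g,
    (forall x y, le A x y -> le B (f x) (f y)) ->
    (forall x y, le A x y -> le B (g x) (g y)) ->
    (forall x, le A x x -> ord w B (f x) (g x)) ->
    ord w (Arr A B) (lam A B f) (lam A B g);
  esub_ord : forall w w' A m n x y,
    (strict -> m <= n) -> (w' = true -> strict -> m < n) -> ord w A x y ->
    ord (w || w') (Box A) (esub A m x) (esub A n y);
  esub_cost : strict -> forall A n x, n < cost (Box A) (esub A n x);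
  val_le : forall A x y, le (Box A) x y -> le A (val A x) (val A y);
  val_esub : forall A n x, val A (esub A n x) = x;
  beta_ord : forall A B f x,
    (forall x y, le A x y -> le B (f x) (f y)) -> le A x x ->
    ord true B (f x) (app A B (lam A B f) x);
  eta1_ord : forall A B p, le (Arr A B) p p ->
    ord true (Arr A B) (lam A B (fun x => charge B (app A B p (charge A x))))
      (charge (Arr A B) p);
  eta2_ord : forall A x, le (Box A) x x ->
    ord true (Box A) (esub A (S (cost (Box A) x)) (charge A (val A x)))
      (charge (Box A) x)
}.

Arguments le {_ _}.
Arguments ord {_} _ {_}.
Arguments cost {_ _}.
Arguments dflt {_}.
Arguments charge {_ _}.
Arguments lam {_ _ _}.
Arguments app {_ _ _}.
Arguments esub {_ _}.
Arguments val {_ _}.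

Lemma ty_eq_dec (A B : ty) : {A = B} + {A <> B}.
Proof. decide equality. apply Nat.eq_dec. Defined.

(** * Interpretation of terms in an ordered model *)

Section Denotation.

Variable Mo : model.

Definition coerce {A B : ty} (x : Mo A) : Mo B :=
  match ty_eq_dec A B with
  | left e => eq_rect A Mo x B e
  | right _ => dflt B
  end.

Lemma coerce_id A (x : Mo A) : coerce x = x.
Proof.
  unfold coerce. destruct (ty_eq_dec A A) as [e|n]; [|congruence].
  rewrite (UIP_dec ty_eq_dec e eq_refl). reflexivity.
Qed.

(* A variable has a value at every type; only the one at its declared type
   matters. *)
Definition env : Type := nat -> forall A, Mo A.

Definition ext {A} (x : Mo A) (r : env) : env :=
  fun i => match i with 0 => fun B => coerce x | S j => r j end.

Definition expandable (M : term) : bool :=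
  match M with Var _ | App _ _ => true | _ => false end.

Definition chg (b : bool) (M : term) {A} (x : Mo A) : Mo A :=
  if (b && expandable M)%bool then charge x else x.

(** The subterms charged here are those that [cstep] visits with flag true; functions of
    applications and arguments of explicit substitutions stay uncharged. The charge of the whole
    term depends on its surroundings and is left to [denb]. *)
Fixpoint den (M : term) (G : ctx) (r : env) (T : ty) : Mo T :=
  match M with
  | Var i => r i T
  | Abs _ M =>
      match T with
      | Arr A B => lam (fun x => chg true M (den M (A :: G) (ext x r) B))
      | _ => dflt _
      end
  | App M N =>
      app (den M G r (Arr (tyof N G) T)) (chg true N (den N G r (tyof N G)))
  | Esub M Ns =>
      match T with
      | Box C =>
          esub (list_sum (map (fun N => S (cost (den N G r (tyof N G)))) Ns))
            (chg true M (den M (map (fun N => unbox_ty (tyof N G)) Ns)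
               (fun i A => nth i (map (fun N => val (den N G r (Box A))) Ns) (dflt A)) C))
      | _ => dflt _
      end
  end.

Definition args_env (Ns : list term) (G : ctx) (r : env) : env :=
  fun i A => nth i (map (fun N => val (den N G r (Box A))) Ns) (dflt A).

Definition args_cost (Ns : list term) (G : ctx) (r : env) : nat :=
  list_sum (map (fun N => S (cost (den N G r (tyof N G)))) Ns).

Definition denb (b : bool) (M : term) (G : ctx) (r : env) (A : ty) : Mo A :=
  chg b M (den M G r A).

Lemma den_Esub M Ns G r As C :
  Forall2 (fun N A => typing G N (Box A)) Ns As ->
  den (Esub M Ns) G r (Box C) =
  esub (args_cost Ns G r) (denb true M As (args_env Ns G r) C).
Proof. intros H. apply map_tyof_typing in H as <-. reflexivity. Qed.

Lemma den_App M N G r A B :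
  typing G N A ->
  den (App M N) G r B = app (den M G r (Arr A B)) (denb true N G r A).
Proof. intros H. apply tyof_typing in H as <-. reflexivity. Qed.

Lemma args_env_nth Ns G r i N A :
  nth_error Ns i = Some N -> args_env Ns G r i A = val (den N G r (Box A)).
Proof.
  intros H. unfold args_env.
  rewrite (nth_error_nth _ _ (dflt A) (map_nth_error _ _ _ H)). reflexivity.
Qed.

Lemma chg_rename b f M A (x : Mo A) : chg b (rename f M) x = chg b M x.
Proof. destruct M; reflexivity. Qed.

(** Agreement is asked at free variables only, so the lemma also covers the deletion of a variable
    by [kappa1]. *)
Lemma den_rename M : forall f G G' r r' A,
  typing G M A ->
  (forall i B, In i (FV M) -> nth_error G i = Some B ->
     nth_error G' (f i) = Some B /\ r' (f i) B = r i B) ->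
  den (rename f M) G' r' A = den M G r A.
Proof.
  induction M as [i|A0 M IH|M N IHM IHN|M Ns IHM IHNs] using term_nested_ind;
    intros f G G' r r' A HT Hf.
  - inversion HT; subst. simpl. apply Hf; simpl; auto.
  - inversion HT; subst. simpl. f_equal. apply functional_extensionality. intros x.
    rewrite chg_rename. f_equal. apply IH; [assumption|].
    intros [|i] B Hi HB; simpl in *; [auto|].
    apply Hf; [now apply in_FV_Abs|assumption].
  - inversion HT; subst. change (rename f (App M N)) with (App (rename f M) (rename f N)).
    erewrite !den_App; [| |eapply typing_rename]; try eassumption;
      [|intros; apply Hf; simpl; auto using in_or_app].
    f_equal; [apply IHM|unfold denb; rewrite chg_rename; f_equal; apply IHN];
      try assumption; intros; apply Hf; simpl; auto using in_or_app.
  - inversion HT as [| | |? ? ? As C HNs HM]; subst.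
    assert (Hf' : forall N i B, In N Ns -> In i (FV N) -> nth_error G i = Some B ->
              nth_error G' (f i) = Some B /\ r' (f i) B = r i B).
    { intros N i B HN Hi. apply Hf. apply in_FV_Esub. eauto. }
    assert (HNs' : Forall2 (fun N A => typing G' N (Box A)) (map (rename f) Ns) As).
    { clear -HNs Hf'. induction HNs; simpl; constructor.
      - eapply typing_rename; [eassumption|]. intros; eapply Hf'; simpl; eauto.
      - apply IHHNs. intros; eapply Hf'; simpl; eauto. }
    change (rename f (Esub M Ns)) with (Esub M (map (rename f) Ns)).
    rewrite (den_Esub _ _ _ _ _ _ HNs), (den_Esub _ _ _ _ _ _ HNs').
    assert (E : Forall2 (fun N A => den (rename f N) G' r' (Box A) = den N G r (Box A)) Ns As).
    { clear -HNs Hf' IHNs. induction HNs; inversion IHNs; subst; constructor.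
      - match goal with H : forall _ : nat -> nat, _ |- _ => apply H end; auto.
        intros; eapply Hf'; simpl; eauto.
      - apply IHHNs; auto. intros; eapply Hf'; simpl; eauto. }
    f_equal.
    + clear -HNs HNs' E. induction HNs; [reflexivity|].
      inversion E; inversion HNs'; subst. unfold args_cost in *. simpl.
      f_equal. f_equal; [|auto].
      erewrite !tyof_typing by eassumption. congruence.
    + unfold denb. f_equal.
      (* Used with the identity renaming, the induction hypothesis says that [den M] depends only on
         the environment at its declared variables. *)
      rewrite <- (IHM (fun i => i) As As (args_env Ns G r)
        (args_env (map (rename f) Ns) G' r')); [now rewrite rename_id|assumption|]. intros i B _ HB. split; [assumption|].
      eapply Forall2_nth_error_r in HB as (N & HN & HB); [|exact E].
      erewrite !args_env_nth; [|eassumption|apply map_nth_error; eassumption].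
      congruence.
Qed.

Lemma denb_rename b M f G G' r r' A :
  typing G M A ->
  (forall i B, In i (FV M) -> nth_error G i = Some B ->
     nth_error G' (f i) = Some B /\ r' (f i) B = r i B) ->
  denb b (rename f M) G' r' A = denb b M G r A.
Proof. intros. unfold denb. rewrite chg_rename. f_equal. now apply den_rename. Qed.

Definition le_env (G : ctx) (r r' : env) : Prop :=
  forall i A, nth_error G i = Some A -> le (r i A) (r' i A).

Lemma le_env_ext G r r' A (x y : Mo A) :
  le_env G r r' -> le x y -> le_env (A :: G) (ext x r) (ext y r').
Proof.
  intros H Hx [|i] B HB; simpl in *; [|auto].
  injection HB as <-. now rewrite !coerce_id.
Qed.

Lemma le_env_refl_l G r r' : le_env G r r' -> le_env G r r.
Proof. intros H i A HA. eapply le_refl_l; eauto. Qed.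

Lemma le_env_refl_r G r r' : le_env G r r' -> le_env G r' r'.
Proof. intros H i A HA. eapply le_refl_r; eauto. Qed.

Lemma ord_false A (x y : Mo A) : le x y -> ord false x y.
Proof. split; [assumption|discriminate]. Qed.

Lemma ord_le w A (x y : Mo A) : ord w x y -> le x y.
Proof. now intros []. Qed.

Lemma ord_trans_l w A (x y z : Mo A) : le x y -> ord w y z -> ord w x z.
Proof.
  intros H1 [H2 H3]. split; [eapply le_trans; eassumption|].
  intros Hw Hs. apply le_cost in H1. specialize (H3 Hw Hs). lia.
Qed.

Lemma ord_trans_r w A (x y z : Mo A) : ord w x y -> le y z -> ord w x z.
Proof.
  intros [H2 H3] H1. split; [eapply le_trans; eassumption|].
  intros Hw Hs. apply le_cost in H1. specialize (H3 Hw Hs). lia.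
Qed.

Lemma chg_ord w b M A (x y : Mo A) : ord w x y -> ord w (chg b M x) (chg b M y).
Proof. intros H. unfold chg. destruct (b && expandable M)%bool; [now apply charge_ord|assumption]. Qed.

Lemma chg_le b M A (x y : Mo A) : le x y -> le (chg b M x) (chg b M y).
Proof. intros H. apply ord_false, (chg_ord _ b M), ord_le in H. assumption. Qed.

Lemma chg_ge b M A (x : Mo A) : le x x -> le x (chg b M x).
Proof.
  intros H. unfold chg. destruct (b && expandable M)%bool; [now apply charge_ge|assumption].
Qed.

Lemma app_le A B (p q : Mo (Arr A B)) x y : le p q -> le x y -> le (app p x) (app q y).
Proof. intros H1 H2. apply (ord_le (false || false)), app_ord; now apply ord_false. Qed.

Lemma args_cost_le Ns Ns' G G' r r' As :
  Forall2 (fun N A => typing G N (Box A)) Ns As ->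
  Forall2 (fun N A => typing G' N (Box A)) Ns' As ->
  (forall i N N' A, nth_error Ns i = Some N -> nth_error Ns' i = Some N' ->
     nth_error As i = Some A -> le (den N G r (Box A)) (den N' G' r' (Box A))) ->
  args_cost Ns G r <= args_cost Ns' G' r'.
Proof.
  intros H; revert Ns'. induction H as [|N A Ns As HN _ IH]; intros Ns' H' Hle;
    inversion H' as [|N' ? Ns1 ? HN' HNs']; subst; unfold args_cost in *; simpl; [lia|].
  rewrite (tyof_typing _ _ _ HN), (tyof_typing _ _ _ HN').
  pose proof (le_cost _ _ _ _ (Hle 0 _ _ _ eq_refl eq_refl eq_refl)).
  specialize (IH _ HNs' (fun i => Hle (S i))). lia.
Qed.

Lemma args_env_le Ns Ns' G G' r r' As :
  Forall2 (fun N A => typing G N (Box A)) Ns As ->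
  Forall2 (fun N A => typing G' N (Box A)) Ns' As ->
  (forall i N N' A, nth_error Ns i = Some N -> nth_error Ns' i = Some N' ->
     nth_error As i = Some A -> le (den N G r (Box A)) (den N' G' r' (Box A))) ->
  le_env As (args_env Ns G r) (args_env Ns' G' r').
Proof.
  intros H H' Hle i A HA.
  destruct (Forall2_nth_error_r _ _ _ _ _ H HA) as (N & HN & _).
  destruct (Forall2_nth_error_r _ _ _ _ _ H' HA) as (N' & HN' & _).
  erewrite !args_env_nth by eassumption. apply val_le. eauto.
Qed.

Lemma esub_le A m n (x y : Mo A) : m <= n -> le x y -> le (esub m x) (esub n y).
Proof.
  intros H1 H2. apply (ord_le (false || false)), esub_ord; auto; [discriminate|].
  now apply ord_false.
Qed.

Lemma den_mono M : forall G r r' A,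
  typing G M A -> le_env G r r' -> le (den M G r A) (den M G r' A).
Proof.
  induction M as [i|A0 M IH|M N IHM IHN|M Ns IHM IHNs] using term_nested_ind;
    intros G r r' A HT Hr; inversion HT as [| | |? ? ? As C HNs HM]; subst.
  - simpl. auto.
  - simpl. apply (ord_le false), lam_ord.
    + intros x y Hxy. apply chg_le, IH; [assumption|].
      apply le_env_ext; [eapply le_env_refl_l|]; eassumption.
    + intros x y Hxy. apply chg_le, IH; [assumption|].
      apply le_env_ext; [eapply le_env_refl_r|]; eassumption.
    + intros x Hx. apply ord_false, chg_le, IH; [assumption|].
      apply le_env_ext; assumption.
  - erewrite !den_App by eassumption. apply app_le; [auto|]. apply chg_le. auto.
  - rewrite !(den_Esub _ _ _ _ _ _ HNs).
    assert (Hle : forall i N N' A, nth_error Ns i = Some N -> nth_error Ns i = Some N' ->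
       nth_error As i = Some A -> le (den N G r (Box A)) (den N' G r' (Box A))).
    { intros i N N' A H1 H2 H3. assert (N' = N) as -> by congruence.
      eapply Forall_forall in IHNs; [|eapply nth_error_In; eassumption].
      apply IHNs; [|assumption].
      destruct (Forall2_nth_error_l _ _ _ _ _ HNs H1) as (B & HB & HN).
      assert (B = A) as -> by congruence. assumption. }
    apply esub_le; [eapply args_cost_le; eassumption|].
    apply chg_le, IHM; [assumption|]. eapply args_env_le; eassumption.
Qed.

Lemma denb_mono b M G r r' A :
  typing G M A -> le_env G r r' -> le (denb b M G r A) (denb b M G r' A).
Proof. intros. now apply chg_le, den_mono. Qed.

Lemma denb_true_ge b M G r A :
  typing G M A -> le_env G r r -> le (denb b M G r A) (denb true M G r A).
Proof.
  intros HT Hr. destruct b; [now apply denb_mono|]. now apply chg_ge, den_mono.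
Qed.

Lemma denb_false_le b M G r A :
  typing G M A -> le_env G r r -> le (den M G r A) (denb b M G r A).
Proof. intros HT Hr. now apply chg_ge, den_mono. Qed.

(* The value substituted for a variable is charged at both its old and its new
   place, whence the inequality and the two-fold hypothesis on [r']. *)
Lemma den_subst M : forall s G G' r r' A,
  typing G M A -> le_env G' r r ->
  (forall i B, nth_error G i = Some B ->
     typing G' (s i) B /\ le (den (s i) G' r B) (r' i B) /\
     le (denb true (s i) G' r B) (charge (r' i B))) ->
  forall b, le (denb b (subst s M) G' r A) (denb b M G r' A).
Proof.
  assert (Hconv : forall M N A (x y : Mo A), expandable M = expandable N ->
            le x y -> forall b, le (chg b M x) (chg b N y)).
  { intros P Q A x y E H b. unfold chg. rewrite E. now apply (chg_le b Q). }
  assert (Hval : forall s G G' r r', (forall i B, nth_error G i = Some B ->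
     typing G' (s i) B /\ le (den (s i) G' r B) (r' i B) /\
     le (denb true (s i) G' r B) (charge (r' i B))) -> le_env G r' r').
  { intros s G G' r r' Hs i B HB. destruct (Hs i B HB) as (_ & H & _).
    eapply le_refl_r; eassumption. }
  induction M as [i|A0 M IH|M N IHM IHN|M Ns IHM IHNs] using term_nested_ind;
    intros s G G' r r' A HT Hr Hs b;
    inversion HT as [|? ? ? ? HM|? ? ? A1 ? HN HM|? ? ? As C HNs HM]; subst.
  - destruct (Hs i A) as (_ & H1 & H2); [assumption|]. destruct b; assumption.
  - apply Hconv; [reflexivity|]. simpl.
    assert (Hs' : forall x : Mo A0, le x x -> forall i B, nth_error (A0 :: G) i = Some B ->
       typing (A0 :: G') (up s i) B /\ le (den (up s i) (A0 :: G') (ext x r) B) (ext x r' i B) /\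
       le (denb true (up s i) (A0 :: G') (ext x r) B) (charge (ext x r' i B))).
    { intros x Hx [|i] B HB; simpl in *.
      - injection HB as <-. rewrite coerce_id. repeat split; [now constructor|assumption|].
        unfold denb. simpl. rewrite coerce_id. now apply (chg_le true (Var 0)).
      - destruct (Hs i B HB) as (H1 & H2 & H3).
        rewrite (den_rename _ _ _ _ r _ _ H1), (denb_rename _ _ _ _ _ r _ _ H1) by auto.
        split; [now apply typing_rename_S|auto]. }
    assert (HTs : forall C, typing (A0 :: G) M C -> typing (A0 :: G') (subst (up s) M) C).
    { intros C0 HC. eapply typing_subst; [eassumption|]. intros [|i] B HB; simpl in *.
      - now constructor.
      - apply typing_rename_S. now apply Hs. }
    apply (ord_le false), lam_ord.
    + intros x y Hxy. apply chg_le, den_mono; [auto|]. now apply le_env_ext.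
    + intros x y Hxy. apply chg_le, den_mono; [auto|].
      apply le_env_ext; [eapply Hval|]; eassumption.
    + intros x Hx. apply ord_false. apply (IH _ _ _ _ _ _ HM); [now apply le_env_ext|auto].
  - apply Hconv; [reflexivity|]. change (subst s (App M N)) with (App (subst s M) (subst s N)).
    erewrite !den_App; [| |eapply typing_subst]; try eassumption; [|intros; now apply Hs].
    apply app_le; [eapply (IHM _ _ _ _ _ _ HM Hr Hs false)|]. eapply IHN; eassumption.
  - apply Hconv; [reflexivity|].
    change (subst s (Esub M Ns)) with (Esub M (map (subst s) Ns)).
    assert (HNs' : Forall2 (fun N A => typing G' N (Box A)) (map (subst s) Ns) As).
    { clear -HNs Hs. induction HNs; simpl; constructor; [|assumption].
      eapply typing_subst; [eassumption|]. intros; now apply Hs. }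
    rewrite (den_Esub _ _ _ _ _ _ HNs), (den_Esub _ _ _ _ _ _ HNs').
    assert (Hle : forall i N N' A, nth_error (map (subst s) Ns) i = Some N ->
       nth_error Ns i = Some N' ->
       nth_error As i = Some A -> le (den N G' r (Box A)) (den N' G r' (Box A))).
    { intros i N N' A H1 H2 H3.
      rewrite (map_nth_error _ _ _ H2) in H1. injection H1 as <-.
      eapply Forall_forall in IHNs; [|eapply nth_error_In; eassumption].
      refine (IHNs _ _ _ _ _ _ _ Hr Hs false).
      destruct (Forall2_nth_error_l _ _ _ _ _ HNs H2) as (B & HB & HN).
      assert (B = A) as -> by congruence. assumption. }
    apply esub_le; [eapply args_cost_le; eassumption|].
    apply chg_le, den_mono; [assumption|]. eapply args_env_le; eassumption.
Qed.

Lemma args_cost_app Ns Ns' G r :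
  args_cost (Ns ++ Ns') G r = args_cost Ns G r + args_cost Ns' G r.
Proof. unfold args_cost. rewrite map_app, list_sum_app. reflexivity. Qed.

Lemma args_cost_cons N Ns G r A :
  typing G N A -> args_cost (N :: Ns) G r = S (cost (den N G r A)) + args_cost Ns G r.
Proof. intros H. apply tyof_typing in H as <-. reflexivity. Qed.

(** * Decrease of the value along steps *)

Definition decreases (w : bool) (R : bool -> ctx -> relation term) : Prop :=
  forall b G M N A r, R b G M N -> typing G M A -> typing G N A -> le_env G r r ->
    ord w (denb b N G r A) (denb b M G r A).

(** Every operation of the model is monotone in each argument, strictly so for costs. The weight [w]
    is true for reductions and false for permutations. *)
Lemma cstep_decreases w R :
  preserves_typing R -> decreases w R -> decreases w (cstep R).
Proof.
  intros HP HR b G M N A r H HM _ Hr. revert A r HM Hr.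
  assert (HPc := cstep_typing _ HP).
  assert (Hconv : forall M N A (x y : Mo A), expandable M = expandable N ->
            ord w x y -> forall b, ord w (chg b M x) (chg b N y)).
  { clear. intros M N A x y E H b. unfold chg. rewrite E. now apply (chg_ord w b N). }
  induction H as [b G M N H|b G A0 M N HS IH|b G M M' N HS IH|b G M N N' HS IH
                 |b G M M' Ns As HNs HS IH|b G M Ns1 N N' Ns2 HS IH];
    intros A r HT Hr; [|inversion HT as [|? ? ? ? HM|? ? ? A1 ? HN HM|? ? ? Bs C HBs HM]; subst;
       apply Hconv; try reflexivity..].
  - eapply HR; eauto.
  - simpl. apply lam_ord.
    + intros x y Hxy. apply chg_le, den_mono; [eapply HPc; eassumption|].
      now apply le_env_ext.
    + intros x y Hxy. apply chg_le, den_mono; [assumption|]. now apply le_env_ext.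
    + intros x Hx. apply IH; [assumption|]. now apply le_env_ext.
  - erewrite !den_App by eassumption.
    rewrite <- (Bool.orb_false_r w). apply app_ord; [now apply IH|].
    now apply ord_false, denb_mono.
  - erewrite !den_App; [| |eapply HPc]; try eassumption.
    apply (app_ord _ false); [|now apply IH]. now apply ord_false, den_mono.
  - pose proof (box_types_unique _ _ _ _ HNs HBs); subst Bs.
    rewrite !(den_Esub _ _ _ _ _ _ HNs).
    rewrite <- (Bool.orb_false_r w). apply esub_ord; [auto|discriminate|].
    apply IH; [assumption|]. eapply args_env_le; try eassumption.
    intros i N N' A H1 H2 H3. assert (N' = N) as -> by congruence. apply den_mono; [|assumption].
    destruct (Forall2_nth_error_l _ _ _ _ _ HNs H1) as (B & HB & HN).
    assert (B = A) as -> by congruence. assumption.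
  - assert (HBs' : Forall2 (fun N A => typing G N (Box A)) (Ns1 ++ N' :: Ns2) Bs).
    { apply Forall2_app_inv_l in HBs as (As1 & As2 & H1 & H2 & ->).
      inversion H2; subst. apply Forall2_app; [assumption|].
      constructor; [eapply HPc; eassumption|assumption]. }
    rewrite (den_Esub _ _ _ _ _ _ HBs), (den_Esub _ _ _ _ _ _ HBs').
    assert (Hle : forall i P P' A, nth_error (Ns1 ++ N' :: Ns2) i = Some P ->
       nth_error (Ns1 ++ N :: Ns2) i = Some P' ->
       nth_error Bs i = Some A -> le (den P G r (Box A)) (den P' G r (Box A))).
    { intros i P P' A HP1 HP2 HA.
      destruct (Forall2_nth_error_l _ _ _ _ _ HBs HP2) as (B & HB & HP3).
      assert (B = A) as -> by congruence.
      destruct (Nat.eq_dec i (length Ns1)) as [->|Hi].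
      - rewrite nth_error_app_cons in HP1, HP2. injection HP1 as <-. injection HP2 as <-.
        eapply ord_le. now apply IH.
      - assert (P' = P) as ->; [|now apply den_mono].
        destruct (Nat.lt_ge_cases i (length Ns1)).
        + rewrite nth_error_app1 in HP1, HP2 by lia. congruence.
        + rewrite nth_error_app2 in HP1, HP2 by lia.
          destruct (i - length Ns1) eqn:E; [lia|]. simpl in *. congruence. }
    (* The body sees the changed argument only through its value, which gives a weak inequality;
       strictness comes from [args_cost], which adds the cost of the uncharged argument. *)
    apply (esub_ord _ false).
    + intros _. eapply args_cost_le; eassumption.
    + intros Hw Hs. apply Forall2_app_inv_l in HBs as (As1 & As2 & H1 & H2 & ->).
      inversion H2 as [|? B ? Bs2 HN HBs2]; subst.
      rewrite !args_cost_app, (args_cost_cons N _ _ _ _ HN),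
        (args_cost_cons N' _ _ _ _ (HPc _ _ _ _ _ HS HN)).
      destruct (IH _ _ HN Hr) as [_ H3]. specialize (H3 eq_refl Hs).
      unfold denb, chg in H3. simpl in H3. lia.
    + apply ord_false, denb_mono; [assumption|]. eapply args_env_le; eassumption.
Qed.

Lemma root_perm_decreases : decreases false root_perm.
Proof.
  intros b G M N A r H HM HN Hr. apply ord_false.
  apply permute_pairs_inv in H
    as (f & g & P & Ns & Ns' & -> & -> & HL & Hf & Hg & Hf' & Hg' & Hgf & Hfg & Hn & Hn').
  enough (denb b (Esub (rename f P) Ns') G r A = denb b (Esub P Ns) G r A) as ->
    by now apply denb_mono.
  unfold denb, chg. simpl expandable. rewrite !Bool.andb_false_r.
  inversion HM as [| | |? ? ? As C HNs HP]; subst. 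
  inversion HN as [| | |? ? ? As' C' HNs' HP']; subst.
  rewrite (den_Esub _ _ _ _ _ _ HNs), (den_Esub _ _ _ _ _ _ HNs'). f_equal.
  - unfold args_cost. apply Permutation_list_sum, Permutation_map, Permutation_nth_error.
    split; [assumption|]. exists f. split; [|now intros i; rewrite Hn].
    intros i j Hij. now rewrite <- (Hgf i), Hij, Hgf.
  - apply denb_rename; [assumption|]. intros i B _ HB.
    destruct (Forall2_nth_error_r _ _ _ _ _ HNs HB) as (Q & HQ & HTQ).
    assert (HQ' : nth_error Ns' (f i) = Some Q) by now rewrite Hn.
    destruct (Forall2_nth_error_l _ _ _ _ _ HNs' HQ') as (B' & HB' & HTQ').
    pose proof (typing_unique _ _ _ _ HTQ HTQ') as E. injection E as <-.
    split; [assumption|]. now erewrite !args_env_nth by eassumption.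
Qed.

(** [den_subst] bounds the reduct by the body evaluated at the charged argument, and [beta_ord] or
    [esub_cost] supplies the strict gap. *)
Lemma beta_decreases b G M N A r :
  beta M N -> typing G M A -> typing G N A -> le_env G r r ->
  ord true (denb b N G r A) (denb b M G r A).
Proof.
  intros [A0 P Q|P Ps R Ns Qs] HM HN Hr.
  - inversion HM as [| |? ? ? A1 ? HQ HP|]; subst. inversion HP as [|? ? ? ? HP'| |]; subst.
    apply ord_trans_r with (den (App (Abs A1 P) Q) G r A); [|now apply denb_false_le].
    rewrite (den_App _ _ _ _ _ _ HQ). simpl.
    assert (HQm : le (denb true Q G r A1) (denb true Q G r A1)) by now apply denb_mono.
    eapply ord_trans_l; [|apply beta_ord with
      (f := fun x => chg true P (den P (A1 :: G) (ext x r) A)); [|exact HQm]].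
    + apply le_trans with (denb b P (A1 :: G) (ext (denb true Q G r A1) r) A);
        [|apply denb_true_ge; [assumption|now apply le_env_ext]].
      apply (den_subst _ _ _ _ _ _ _ HP' Hr).
      intros [|i] B HB; simpl in *.
      * injection HB as <-. rewrite coerce_id. split; [assumption|].
        split; [now apply denb_false_le|]. now apply charge_ge.
      * split; [now constructor|]. split; [now apply Hr|].
        unfold denb, chg. simpl. now apply (chg_le true (Var 0)), Hr.
    + intros x y Hxy. apply chg_le, den_mono; [assumption|]. now apply le_env_ext.
  (* No explicit substitution is expandable, so [Esub P Ps] can stand for either side up to
     conversion. *)
  - apply chg_ord with (w := true) (b := b) (M := Esub P Ps). 
    inversion HM as [| | |? ? ? As0 C HNs HP]; subst.
    inversion HN as [| | |? ? ? As' C' HNs' HP']; subst.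
    rewrite (den_Esub _ _ _ _ _ _ HNs), (den_Esub _ _ _ _ _ _ HNs').
    apply Forall2_app_inv_l in HNs as (As1 & As2 & HPs & H2 & ->).
    inversion H2 as [|? A1 ? As3 HR HQ]; subst.
    inversion HR as [| | |? ? ? Bs ? HNs HRt]; subst.
    pose proof (Forall2_length HPs) as LP. pose proof (Forall2_length HNs) as LN.
    assert (As' = As1 ++ Bs ++ As3) as ->.
    { eapply box_types_unique; [exact HNs'|].
      apply Forall2_app; [assumption|apply Forall2_app; assumption]. }
    assert (HrN : forall Ls Ts, Forall2 (fun N A => typing G N (Box A)) Ls Ts ->
              le_env Ts (args_env Ls G r) (args_env Ls G r)).
    { intros Ls Ts HL. eapply args_env_le; try eassumption.
      intros i L L' T H3 H4 H5. assert (L' = L) as -> by congruence.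
      apply den_mono; [|assumption].
      destruct (Forall2_nth_error_l _ _ _ _ _ HL H3) as (B & HB & HT).
      assert (B = T) as -> by congruence. assumption. }
    (* The costs of [Ns] move out of the cost of [Esub R Ns], which strictly exceeded their sum. *)
    assert (Hlt : strict Mo -> args_cost (Ps ++ Ns ++ Qs) G r <
                               args_cost (Ps ++ Esub R Ns :: Qs) G r).
    { intros Hs. rewrite !args_cost_app, (args_cost_cons _ _ _ _ _ HR).
      rewrite (den_Esub _ _ _ _ _ _ HNs).
      pose proof (esub_cost _ Hs A1 (args_cost Ns G r)
                    (denb true R Bs (args_env Ns G r) A1)). lia. }
    apply (esub_ord _ false true); [intros Hs; specialize (Hlt Hs); lia|auto|].
    apply ord_false. apply (den_subst _ _ _ _ _ _ _ HP); [now apply HrN|].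
    intros i B HB.
    assert (Hvar : forall j, nth_error (As1 ++ Bs ++ As3) j = Some B ->
       nth_error (Ps ++ Ns ++ Qs) j = nth_error (Ps ++ Esub R Ns :: Qs) i ->
       typing (As1 ++ Bs ++ As3) (Var j) B /\
       le (den (Var j) (As1 ++ Bs ++ As3) (args_env (Ps ++ Ns ++ Qs) G r) B)
         (args_env (Ps ++ Esub R Ns :: Qs) G r i B) /\
       le (denb true (Var j) (As1 ++ Bs ++ As3) (args_env (Ps ++ Ns ++ Qs) G r) B)
         (charge (args_env (Ps ++ Esub R Ns :: Qs) G r i B))).
    { intros j Hj E. split; [now constructor|].
      destruct (Forall2_nth_error_r _ _ _ _ _ HNs' Hj) as (L & HL & _).
      assert (E2 : args_env (Ps ++ Esub R Ns :: Qs) G r i B =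
                   args_env (Ps ++ Ns ++ Qs) G r j B).
      { erewrite !args_env_nth by (rewrite <- ?E; eassumption). reflexivity. }
      rewrite E2. pose proof (HrN _ _ HNs' _ _ Hj) as HL'. split; [exact HL'|].
      now apply (chg_le true (Var j)). }
    unfold splice. destruct (Nat.ltb_spec i (length Ps)).
    + apply Hvar; rewrite !nth_error_app1 in * by lia; auto.
    + rewrite nth_error_app2 in HB by lia.
      destruct (Nat.eqb_spec i (length Ps)) as [->|].
      * replace (length Ps - length As1) with 0 in HB by lia. injection HB as <-.
        assert (Hren : forall i B, In i (FV R) -> nth_error Bs i = Some B ->
          nth_error (As1 ++ Bs ++ As3) (length Ps + i) = Some B /\
          args_env (Ps ++ Ns ++ Qs) G r (length Ps + i) B = args_env Ns G r i B).
        { intros j C0 _ HC. destruct (Forall2_nth_error_r _ _ _ _ _ HNs HC) as (L & HL & _).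
          split.
          - apply nth_error_some_lt in HC as Lj.
            rewrite nth_error_app2 by lia. rewrite nth_error_app1 by lia.
            rewrite <- HC. f_equal; lia.
          - erewrite !args_env_nth; [reflexivity|eassumption|].
            apply nth_error_some_lt in HL as Lj.
            rewrite nth_error_app2 by lia. rewrite nth_error_app1 by lia.
            rewrite <- HL. f_equal; lia. }
        rewrite (den_rename _ _ _ _ _ _ _ HRt Hren), (denb_rename _ _ _ _ _ _ _ _ HRt Hren).
        erewrite (args_env_nth (Ps ++ Esub R Ns :: Qs)) by apply nth_error_app_cons.
        (* [val] drops the costs of the arguments and leaves the charged value of [R], which
           dominates [R] uncharged and, after one more charge, [R] charged. *)
        rewrite (den_Esub _ _ _ _ _ _ HNs), val_esub.
        pose proof (HrN _ _ HNs) as Hr'. split; [|split].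
        -- eapply typing_rename; [exact HRt|]. intros j C0 Hj HC. now apply Hren.
        -- now apply denb_false_le.
        -- apply charge_ge. now apply denb_mono.
      * apply Hvar.
        -- rewrite !nth_error_app2 by lia.
           replace (i - length As1) with (S (pred i - length As1)) in HB by lia.
           simpl in HB. rewrite <- HB. f_equal; lia.
        -- rewrite !nth_error_app2 by lia.
           replace (i - length Ps) with (S (pred i - length Ps)) by lia.
           simpl. f_equal; lia.
Qed.

(** In both rules the renaming leaves each free variable of the body with the argument it had, so
    the value of the body does not change. The sum of costs drops because every argument contributes
    at least one. *)
Lemma kappa_decreases b G M N A r :
  kappa M N -> typing G M A -> typing G N A -> le_env G r r ->
  ord true (denb b N G r A) (denb b M G r A).
Proof.
  intros H HM HN Hr.
  enough (exists P f As As' Ns Ns' C, M = Esub P Ns /\ N = Esub (rename f P) Ns' /\ A = Box C /\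
    Forall2 (fun N A => typing G N (Box A)) Ns As /\
    Forall2 (fun N A => typing G N (Box A)) Ns' As' /\ typing As P C /\
    args_cost Ns' G r < args_cost Ns G r /\
    (forall i, In i (FV P) -> i < length Ns -> nth_error Ns' (f i) = nth_error Ns i))
    as (P & f & As & As' & Ns & Ns' & C & -> & -> & -> & H1 & H2 & H3 & H6 & H7).
  { apply chg_ord with (w := true) (b := b) (M := Esub P Ns).
    rewrite (den_Esub _ _ _ _ _ _ H1), (den_Esub _ _ _ _ _ _ H2).
    apply (esub_ord _ false true); [lia|auto|].
    rewrite (denb_rename _ _ _ _ _ (args_env Ns G r) _ _ H3).
    - apply ord_false, denb_mono; [assumption|]. eapply args_env_le; try eassumption.
      intros i L L' T H8 H9 H10. assert (L' = L) as -> by congruence.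
      apply den_mono; [|assumption].
      destruct (Forall2_nth_error_l _ _ _ _ _ H1 H8) as (B & HB & HT).
      assert (B = T) as -> by congruence. assumption.
    - intros i B Hi HB. destruct (Forall2_nth_error_r _ _ _ _ _ H1 HB) as (L & HL & HT).
      assert (HL' : nth_error Ns' (f i) = Some L)
        by (rewrite H7; [assumption..|eapply nth_error_some_lt; eassumption]).
      destruct (Forall2_nth_error_l _ _ _ _ _ H2 HL') as (B' & HB' & HT').
      pose proof (typing_unique _ _ _ _ HT HT') as E. injection E as <-.
      split; [assumption|]. now erewrite !args_env_nth by eassumption. }
  destruct H as [P Ps L Qs Hp|P Ps L Qs]; inversion HM as [| | |? ? ? As C HNs HP]; subst;
    inversion HN as [| | |? ? ? As' C' HNs' HP']; subst;
    eexists P, (lower (length Ps)), As, As', _, _, C; repeat (split; [eauto; fail|]);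
    (split; [apply Forall2_app_inv_l in HNs as (As1 & As2 & HPs & H2 & ->);
       inversion H2 as [|? A1 ? As3 HR HQ]; subst|]).
  - rewrite !args_cost_app, (args_cost_cons _ _ _ _ _ HR). lia.
  - intros i Hi Hlt. unfold lower. destruct (Nat.leb_spec i (length Ps)).
    + assert (i <> length Ps) by congruence. rewrite !nth_error_app1 by lia. reflexivity.
    + rewrite !nth_error_app2 by lia.
      replace (i - length Ps) with (S (pred i - length Ps)) by lia. reflexivity.
  - rewrite !args_cost_app, !(args_cost_cons _ _ _ _ _ HR). lia.
  - intros i Hi Hlt. unfold lower. destruct (Nat.leb_spec i (length Ps)).
    + destruct (Nat.eq_dec i (length Ps)) as [->|].
      * now rewrite !nth_error_app_cons.
      * rewrite !nth_error_app1 by lia. reflexivity.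
    + rewrite !nth_error_app2 by lia.
      replace (i - length Ps) with (S (pred i - length Ps)) by lia. simpl.
      destruct (pred i - length Ps); reflexivity.
Qed.

Lemma expandable_arr G M A B : typing G M (Arr A B) -> ~ is_abs M -> expandable M = true.
Proof.
  intros HT HM. inversion HT; subst; try reflexivity. destruct HM. unfold is_abs; eauto.
Qed.

Lemma expandable_box G M A : typing G M (Box A) -> ~ is_esub M -> expandable M = true.
Proof.
  intros HT HM. inversion HT; subst; try reflexivity. destruct HM. unfold is_esub; eauto.
Qed.

(** Expansion uncharges the old term and charges the new variable and the new body, which are the
    very expressions on the left of [eta1_ord] and [eta2_ord]. *)
Lemma root_red_decreases : decreases true root_red.
Proof.
  intros b G M N A r H HM HN Hr. destruct H as [b G M N H|b G M N H|G M N H|G M N H].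
  - now apply beta_decreases.
  - now apply kappa_decreases.
  - destruct H as [M A1 B HT Hna]. pose proof (typing_unique _ _ _ _ HT HM) as <-.
    unfold denb at 2, chg. rewrite (expandable_arr _ _ _ _ HT Hna). simpl.
    match goal with |- ord true ?x _ => replace x with
      (lam (fun y => charge (app (den M G r (Arr A1 B)) (charge y)))) end;
      [now apply eta1_ord, den_mono|].
    unfold denb, chg. simpl. f_equal. apply functional_extensionality. intros y.
    unfold chg; simpl. rewrite coerce_id. rewrite (den_rename _ _ _ _ r _ _ HT) by auto.
    reflexivity.
  - destruct H as [M A1 HT Hne]. pose proof (typing_unique _ _ _ _ HT HM) as <-.
    unfold denb at 2, chg. rewrite (expandable_box _ _ _ HT Hne). simpl.
    unfold denb. unfold chg at 1. simpl expandable. cbv iota beta delta [andb].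
    rewrite (den_Esub _ _ _ _ [A1]) by (constructor; [assumption|constructor]).
    rewrite (args_cost_cons _ _ _ _ _ HT). unfold args_cost; simpl. rewrite Nat.add_0_r.
    now apply eta2_ord, den_mono.
Qed.

End Denotation.

(** * The cost model and strong normalization *)

Fixpoint cm (A : ty) : Type :=
  match A with
  | Atom _ => nat
  | Arr A B => (nat * (cm A -> cm B))%type
  | Box A => (nat * cm A)%type
  end.

(** At arrow types both ends are required to be monotone, so [cm_le A x x] is hereditary
    monotonicity and the pointwise comparison can be limited to the diagonal. *)
Fixpoint cm_le (A : ty) : cm A -> cm A -> Prop :=
  match A with
  | Atom _ => fun x y => x <= y
  | Arr A B => fun p q =>
      fst p <= fst q /\
      (forall x y, cm_le A x y -> cm_le B (snd p x) (snd p y)) /\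
      (forall x y, cm_le A x y -> cm_le B (snd q x) (snd q y)) /\
      (forall x, cm_le A x x -> cm_le B (snd p x) (snd q x))
  | Box A => fun p q => fst p <= fst q /\ cm_le A (snd p) (snd q)
  end.

Definition cm_cost (A : ty) : cm A -> nat :=
  match A with Atom _ => fun x => x | Arr _ _ => fst | Box _ => fst end.

Definition cm_add (n : nat) (A : ty) : cm A -> cm A :=
  match A with
  | Atom _ => fun x => n + x
  | Arr _ _ => fun p => (n + fst p, snd p)
  | Box _ => fun p => (n + fst p, snd p)
  end.

Fixpoint cm_zero (A : ty) : cm A :=
  match A with
  | Atom _ => 0
  | Arr A B => (0, fun _ => cm_zero B)
  | Box A => (0, cm_zero A)
  end.

(** Sampling the body at one monotone element is enough to make a step under the abstraction visible
    in the cost. *)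
Definition cm_lam (A B : ty) (f : cm A -> cm B) : cm (Arr A B) :=
  (cm_cost B (f (cm_zero A)), f).

(** The costs of function and argument are added to the result, so that steps in an erased argument
    still count; the successor makes beta strict. *)
Definition cm_app (A B : ty) (p : cm (Arr A B)) (x : cm A) : cm B :=
  cm_add (S (fst p + cm_cost A x)) B (snd p x).

Definition cm_esub (A : ty) (n : nat) (x : cm A) : cm (Box A) := (S (n + cm_cost A x), x).

(** At arrow and box types this is the value of the expansion of a term with value [p], plus one.
    The successor in [S (fst p)] is the unit that [args_cost] adds for a single argument. *)
Fixpoint cm_charge (A : ty) : cm A -> cm A :=
  match A with
  | Atom _ => fun x => x
  | Arr A B => fun p =>
      cm_add 1 (Arr A B) (cm_lam A B (fun x => cm_charge B (cm_app A B p (cm_charge A x))))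
  | Box A => fun p =>
      cm_add 1 (Box A) (cm_esub A (S (fst p)) (cm_charge A (snd p)))
  end.

Definition cm_ord (w : bool) A (x y : cm A) : Prop :=
  cm_le A x y /\ (w = true -> True -> cm_cost A x < cm_cost A y).

Lemma cm_le_refl_l A x y : cm_le A x y -> cm_le A x x.
Proof.
  revert x y; induction A as [a|A IHA B IHB|A IH]; simpl; intros x y H.
  - lia.
  - destruct H as (H1 & H2 & H3 & H4). repeat split; auto.
  - destruct H. split; eauto.
Qed.

Lemma cm_le_refl_r A x y : cm_le A x y -> cm_le A y y.
Proof.
  revert x y; induction A as [a|A IHA B IHB|A IH]; simpl; intros x y H.
  - lia.
  - destruct H as (H1 & H2 & H3 & H4). repeat split; auto.
  - destruct H. split; eauto.
Qed.

Lemma cm_le_trans A : transitive _ (cm_le A).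
Proof.
  induction A as [a|A IHA B IHB|A IH]; simpl; intros x y z H K.
  - lia.
  - destruct H as (H1 & H2 & H3 & H4), K as (K1 & K2 & K3 & K4).
    repeat split; auto; [lia|]. intros u Hu. eapply IHB; eauto.
  - destruct H, K. split; [lia|]. eapply IH; eassumption.
Qed.

Lemma cm_le_cost A x y : cm_le A x y -> cm_cost A x <= cm_cost A y.
Proof. destruct A; simpl; tauto. Qed.

Lemma cm_zero_valid A : cm_le A (cm_zero A) (cm_zero A).
Proof.
  induction A as [a|A IHA B IHB|A IH]; simpl; auto.
Qed.

Lemma cm_add_le m n A x y : m <= n -> cm_le A x y -> cm_le A (cm_add m A x) (cm_add n A y).
Proof.
  intros Hmn. destruct A; simpl.
  - lia.
  - intros (H1 & H2 & H3 & H4). repeat split; auto. lia.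
  - intros [H1 H2]. split; [lia|auto].
Qed.

Lemma cm_add_ge n A x : cm_le A x x -> cm_le A x (cm_add n A x).
Proof.
  destruct A; simpl.
  - lia.
  - intros (H1 & H2 & H3 & H4). repeat split; auto. lia.
  - intros [H1 H2]. split; [lia|auto].
Qed.

Lemma cm_cost_add n A x : cm_cost A (cm_add n A x) = n + cm_cost A x.
Proof. destruct A; reflexivity. Qed.

Lemma cm_app_ord w w' A B p q x y :
  cm_ord w (Arr A B) p q -> cm_ord w' A x y ->
  cm_ord (w || w') B (cm_app A B p x) (cm_app A B q y).
Proof.
  intros [(H1 & H2 & H3 & H4) H5] [H6 H7]. simpl in H5.
  pose proof (cm_le_cost _ _ _ H6).
  assert (H8 : cm_le B (snd p x) (snd q y)).
  { eapply cm_le_trans; [exact (H2 _ _ H6)|]. apply H4. eapply cm_le_refl_r; eassumption. }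
  pose proof (cm_le_cost _ _ _ H8). split.
  - apply cm_add_le; [lia|assumption].
  - intros Hw Ht. unfold cm_app. rewrite !cm_cost_add.
    destruct w; [specialize (H5 eq_refl Ht); lia|]. specialize (H7 Hw Ht). lia.
Qed.

Lemma cm_lam_ord w A B f g :
  (forall x y, cm_le A x y -> cm_le B (f x) (f y)) ->
  (forall x y, cm_le A x y -> cm_le B (g x) (g y)) ->
  (forall x, cm_le A x x -> cm_ord w B (f x) (g x)) ->
  cm_ord w (Arr A B) (cm_lam A B f) (cm_lam A B g).
Proof.
  intros Hf Hg Hfg. destruct (Hfg _ (cm_zero_valid A)) as [H1 H2]. split; [|exact H2].
  simpl. repeat split; auto; [now apply cm_le_cost|]. intros x Hx. now apply Hfg.
Qed.

Lemma cm_esub_ord w w' A m n x y :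
  (True -> m <= n) -> (w' = true -> True -> m < n) -> cm_ord w A x y ->
  cm_ord (w || w') (Box A) (cm_esub A m x) (cm_esub A n y).
Proof.
  intros H1 H2 [H3 H4]. specialize (H1 I). pose proof (cm_le_cost _ _ _ H3). split.
  - simpl. split; [lia|assumption].
  - intros Hw Ht. simpl. destruct w; [specialize (H4 eq_refl Ht); lia|].
    specialize (H2 Hw Ht). lia.
Qed.

Lemma cm_ord_false A x y : cm_le A x y -> cm_ord false A x y.
Proof. split; [assumption|discriminate]. Qed.

Lemma cm_charge_ord w A x y : cm_ord w A x y -> cm_ord w A (cm_charge A x) (cm_charge A y).
Proof.
  revert w x y; induction A as [a|A IHA B IHB|A IH]; intros w x y H.
  - exact H.
  - assert (Hc : forall w p q, cm_ord w (Arr A B) p q -> forall u v, cm_le A u v ->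
      cm_ord w B (cm_charge B (cm_app A B p (cm_charge A u)))
                 (cm_charge B (cm_app A B q (cm_charge A v)))).
    { intros w0 p q Hpq u v Huv. apply IHB. rewrite <- (Bool.orb_false_r w0).
      apply cm_app_ord; [assumption|]. apply IHA. now apply cm_ord_false. }
    assert (Hr : cm_le (Arr A B) x x /\ cm_le (Arr A B) y y)
      by (destruct H; split; [eapply cm_le_refl_l|eapply cm_le_refl_r]; eassumption).
    destruct Hr as [Hx Hy].
    assert (HL : cm_ord w (Arr A B)
       (cm_lam A B (fun u => cm_charge B (cm_app A B x (cm_charge A u))))
       (cm_lam A B (fun u => cm_charge B (cm_app A B y (cm_charge A u))))).
    { apply cm_lam_ord; [| |auto]; intros u v Huv; eapply (Hc false); auto;
        now apply cm_ord_false. }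
    destruct HL as [HL1 HL2]. split; [now apply (cm_add_le 1 1 (Arr A B))|].
    intros Hw Ht. specialize (HL2 Hw Ht). cbn in *. lia.
  - destruct H as [[H1 H2] H3]. simpl in H3.
    destruct (IH false _ _ (cm_ord_false _ _ _ H2)) as [H4 _].
    pose proof (cm_le_cost _ _ _ H4). split; simpl.
    + split; [lia|assumption].
    + intros Hw Ht. specialize (H3 Hw Ht). lia.
Qed.

Lemma cm_charge_ge A x : cm_le A x x -> cm_le A x (cm_charge A x).
Proof.
  revert x; induction A as [a|A IHA B IHB|A IH]; intros x H.
  - exact H.
  - assert (H' := H). destruct H' as (H1 & H2 & _ & _).
    pose proof (proj1 (cm_charge_ord _ _ _ _ (cm_ord_false _ _ _ H))) as (K1 & K2 & _ & _).
    (* Keeping the summand [fst x] makes one bound serve twice: at [cm_zero] it compares the costs,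
       at any other [u] the values. *)
    assert (Hpt : forall u, cm_le A u u ->
              cm_le B (cm_add (S (fst x + cm_cost A (cm_charge A u))) B (snd x u))
                (snd (cm_charge (Arr A B) x) u)).
    { intros u Hu. simpl. eapply cm_le_trans; [|apply IHB].
      - apply cm_add_le; [lia|]. apply H2. now apply IHA.
      - apply cm_add_le; [lia|]. apply H2.
        eapply cm_le_refl_r. now apply IHA. }
    split; [|split; [exact H2|split; [exact K2|]]].
    + pose proof (cm_le_cost _ _ _ (Hpt _ (cm_zero_valid A))) as Hz.
      rewrite cm_cost_add in Hz. cbn in *. lia.
    + intros u Hu. eapply cm_le_trans; [|now apply Hpt]. now apply cm_add_ge, H2.
  - destruct H as [H1 H2]. split; cbn; [lia|]. now apply IH.
Qed.

Definition cost_model : model.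
Proof.
  refine {| carrier := cm; le := cm_le; cost := cm_cost; strict := True; dflt := cm_zero;
            charge := cm_charge; lam := cm_lam; app := cm_app; esub := cm_esub;
            val := fun A => snd |}.
  - exact cm_le_refl_l.
  - exact cm_le_refl_r.
  - exact cm_le_trans.
  - exact cm_le_cost.
  - exact cm_charge_ord.
  - exact cm_charge_ge.
  - exact cm_app_ord.
  - exact cm_lam_ord.
  - exact cm_esub_ord.
  - intros _ A n x. simpl. lia.
  - intros A x y [_ H]. exact H.
  - reflexivity.
  - intros A B f x Hf Hx. split.
    + now apply cm_add_ge, Hf.
    + intros _ _. unfold cm_app. rewrite cm_cost_add. simpl. lia.
  - intros A B p Hp. split.
    + apply (cm_add_ge 1 (Arr A B)).
      eapply (proj1 (cm_lam_ord false _ _ _ _ _ _ _)).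
      Unshelve.
      all: intros; try apply cm_ord_false; apply cm_charge_ord with (w := false);
        apply (cm_app_ord false false); try (apply cm_charge_ord); now apply cm_ord_false.
    + intros _ _. cbn. lia.
  - intros A x Hx. split.
    + apply (cm_add_ge 1 (Box A)). destruct Hx as [_ Hx]. split; [simpl; lia|].
      now apply (cm_charge_ord false), cm_ord_false.
    + intros _ _. cbn. lia.
Defined.

(** * The measure on typable terms *)

Lemma teq_den_le (Mo : model) G A M N r :
  teq M N -> typing G M A -> le_env Mo G r r ->
  le (denb Mo true N G r A) (denb Mo true M G r A).
Proof.
  intros H HT. revert r.
  refine (proj2 (teq_typed_ind (fun G A M N => forall r, le_env Mo G r r ->
    le (denb Mo true N G r A) (denb Mo true M G r A)) _ _ _ G A M N H HT)); clear.
  - intros G A M HT r Hr. now apply denb_mono.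
  - intros G A M N P H1 H2 r Hr. eapply le_trans; [now apply H2|now apply H1].
  - intros G A M N HM HN H r Hr. eapply ord_le.
    eapply cstep_decreases; eauto using root_perm_typing, root_perm_decreases.
Qed.

Lemma Lambda_red_decreases (Mo : model) G (x y : Lambda G) A r :
  Lambda_red G x y -> typing G (proj1_sig x) A -> le_env Mo G r r ->
  typing G (proj1_sig y) A /\
  ord true (denb Mo true (proj1_sig y) G r A) (denb Mo true (proj1_sig x) G r A).
Proof.
  intros (M & N & H1 & H2 & H3) HT Hr.
  pose proof (teq_typing _ _ _ _ H1 HT) as HM.
  pose proof (red_cstep _ _ _ _ HM H2) as HS.
  pose proof (cstep_typing _ root_red_typing _ _ _ _ _ HS HM) as HN.
  split; [eapply teq_typing; eassumption|].
  eapply ord_trans_l; [eapply teq_den_le; eassumption|].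
  eapply ord_trans_r; [|eapply teq_den_le; eassumption].
  eapply cstep_decreases; eauto using root_red_typing, root_red_decreases.
Qed.

(** The type is recomputed by [tyof], as the one in the existential proof cannot be extracted to
    build a number. *)
Definition measure (G : ctx) (x : Lambda G) : nat :=
  let M := proj1_sig x in
  cost (denb cost_model true M G (fun _ => cm_zero) (tyof M G)).

Lemma Lambda_red_measure G (x y : Lambda G) : Lambda_red G x y -> measure G y < measure G x.
Proof.
  intros H. destruct (proj2_sig x) as [A HA].
  destruct (Lambda_red_decreases cost_model G x y A (fun _ => cm_zero) H HA)
    as [HB [_ Hlt]]; [intros i B _; apply cm_zero_valid|].
  unfold measure. rewrite (tyof_typing _ _ _ HA), (tyof_typing _ _ _ HB).
  exact (Hlt eq_refl I).
Qed.

Lemma Lambda_red_strongly_normalizing G : strongly_normalizing (Lambda_red G).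
Proof.
  intros [f Hf].
  assert (H : forall n, measure G (f n) + n <= measure G (f 0)).
  { induction n as [|n IH]; [lia|]. pose proof (Lambda_red_measure _ _ _ (Hf n)). lia. }
  specialize (H (S (measure G (f 0)))). lia.
Qed.

(** * Long normal forms *)

(** Flag false marks neutral terms, whose type is read off from the head variable. At flag true they
    must be atomic, as they could otherwise be expanded. The last two premises of [lnf_esub] express
    normality for [kappa1] and, up to permutations, for [kappa2]. *)
Inductive lnf : bool -> ctx -> term -> ty -> Prop :=
| lnf_var G i A : nth_error G i = Some A -> lnf false G (Var i) A
| lnf_app G M N A B :
    lnf false G M (Arr A B) -> lnf true G N A -> lnf false G (App M N) B
| lnf_atom G M a : lnf false G M (Atom a) -> lnf true G M (Atom a)
| lnf_abs G A M B : lnf true (A :: G) M B -> lnf true G (Abs A M) (Arr A B)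
| lnf_esub G M Ns As C :
    Forall2 (fun N A => lnf false G N (Box A)) Ns As ->
    lnf true As M C ->
    (forall i, i < length Ns -> In i (FV M)) ->
    (forall i j N N', nth_error Ns i = Some N -> nth_error Ns j = Some N' ->
       teq N N' -> i = j) ->
    lnf true G (Esub M Ns) (Box C).

Definition normal (b : bool) (G : ctx) (M : term) : Prop :=
  forall M' N, teq M M' -> ~ cstep root_red b G M' N.

(** [kappa2] needs equal and adjacent arguments. Since normality is taken modulo [teq], the two can
    be moved to the front and the second rewritten into the first. *)
Lemma normal_no_dup b G M Ns i j N N' :
  normal b G (Esub M Ns) -> i < j ->
  nth_error Ns i = Some N -> nth_error Ns j = Some N' -> ~ teq N N'.
Proof.
  intros Hn Hij Hi Hj HN.
  apply nth_error_split in Hi as (L1 & L2 & -> & <-).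
  rewrite nth_error_app2 in Hj by lia.
  destruct (j - length L1) as [|k] eqn:E; [lia|]. simpl in Hj.
  apply nth_error_split in Hj as (L3 & L4 & -> & _).
  assert (HP : Permutation (L1 ++ N :: L3 ++ N' :: L4) (N :: N' :: L1 ++ L3 ++ L4)).
  { rewrite <- Permutation_middle. constructor.
    rewrite app_assoc, <- Permutation_middle, app_assoc. reflexivity. }
  destruct (permute_pairs_of_Permutation M _ _ HP) as [f Hf].
  refine (Hn (Esub (rename f M) ([] ++ N :: N :: L1 ++ L3 ++ L4)) _ _ _).
  - eapply rst_trans; [apply rst_step; apply (Closure _ _ Hole _ _ I Hf)|].
    apply (teq_fill (HArg (rename f M) [N] Hole (L1 ++ L3 ++ L4))).
    now apply rst_sym.
  - apply cs_root, rr_kappa, kappa2.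
Qed.

(** The condition at flag false comes from the surroundings: in function position [beta1] excludes
    abstractions and typing excludes explicit substitutions; in argument position [beta2] and typing
    exchange these roles. *)
Lemma normal_lnf M : forall b G A,
  typing G M A -> normal b G M ->
  (b = false -> ~ is_abs M /\ ~ is_esub M) -> lnf b G M A.
Proof.
  assert (Hat : forall M G A, typing G M A -> normal true G M -> expandable M = true ->
            lnf false G M A -> lnf true G M A).
  { intros P G A HT Hn HM H. destruct A as [a|A B|A].
    - now constructor.
    - exfalso. eapply Hn; [apply rst_refl|]. apply cs_root, rr_eta1.
      econstructor; [eassumption|]. intros (A0 & Q & ->). discriminate.
    - exfalso. eapply Hn; [apply rst_refl|]. apply cs_root, rr_eta2.
      econstructor; [eassumption|]. intros (Q & Ps & ->). discriminate. }
  induction M as [i|A0 M IH|M N IHM IHN|M Ns IHM IHNs] using term_nested_ind;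
    intros b G A HT Hn Hb.
  - assert (lnf false G (Var i) A) by (inversion HT; now constructor).
    destruct b; auto.
  - destruct b; [|destruct (Hb eq_refl) as [H _]; destruct H; unfold is_abs; eauto].
    inversion HT; subst. constructor. apply IH; [assumption| |discriminate].
    intros M' N HM HS. apply (Hn (Abs A0 M') (Abs A0 N)).
    + exact (teq_fill (HAbs A0 Hole) _ _ HM).
    + now constructor.
  - assert (lnf false G (App M N) A).
    { inversion HT as [| |? ? ? A1 ? HN HM|]; subst. apply lnf_app with A1.
      - apply IHM; [assumption| |].
        + intros M' N' H1 H2. apply (Hn (App M' N) (App N' N)).
          * exact (teq_fill (HAppL Hole N) _ _ H1).
          * now constructor.
        + intros _. split.
          * intros (A2 & P & ->). eapply Hn; [apply rst_refl|]. apply cs_root, rr_beta, beta1.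
          * intros (P & Ps & ->). inversion HM.
      - apply IHN; [assumption| |discriminate].
        intros M' N' H1 H2. apply (Hn (App M M') (App M N')).
        + exact (teq_fill (HAppR M Hole) _ _ H1).
        + now constructor. }
    destruct b; auto.
  - destruct b; [|destruct (Hb eq_refl) as [_ H]; destruct H; unfold is_esub; eauto].
    inversion HT as [| | |? ? ? As C HNs HM]; subst. apply lnf_esub with As.
    + apply Forall2_of_nth_error; [eapply Forall2_length; eassumption|].
      intros i N A Hi HA.
      destruct (Forall2_nth_error_l _ _ _ _ _ HNs Hi) as (B & HB & HN).
      assert (B = A) as -> by congruence.
      eapply Forall_forall in IHNs; [|eapply nth_error_In; eassumption].
      apply nth_error_split in Hi as (L1 & L2 & -> & _).
      apply IHNs; [assumption| |].
      * intros M' N' H1 H2. apply (Hn (Esub M (L1 ++ M' :: L2)) (Esub M (L1 ++ N' :: L2))).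
        -- exact (teq_fill (HArg M L1 Hole L2) _ _ H1).
        -- now constructor.
      * intros _. split.
        -- intros (A2 & P & ->). inversion HN.
        -- intros (P & Ps & ->). eapply Hn; [apply rst_refl|]. apply cs_root, rr_beta, beta2.
    + apply IHM; [assumption| |discriminate].
      intros M' N' H1 H2. apply (Hn (Esub M' Ns) (Esub N' Ns)).
      * exact (teq_fill (HBody Hole Ns) _ _ H1).
      * econstructor; eassumption.
    + intros i Hi. apply NNPP. intros Hni.
      destruct (nth_error_lt _ _ Hi) as [N HN].
      apply nth_error_split in HN as (L1 & L2 & -> & <-).
      eapply Hn; [apply rst_refl|]. now apply cs_root, rr_kappa, kappa1.
    + intros i j N N' H1 H2 H3. destruct (Nat.lt_trichotomy i j) as [H|[H|H]]; [|assumption|].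
      * destruct (normal_no_dup _ _ _ _ _ _ _ _ Hn H H1 H2 H3).
      * destruct (normal_no_dup _ _ _ _ _ _ _ _ Hn H H2 H1). now apply rst_sym.
Qed.

Lemma lnf_typing M : forall b G A, lnf b G M A -> typing G M A.
Proof.
  induction M as [i|A0 M IH|M N IHM IHN|M Ns IHM IHNs] using term_nested_ind;
    intros b G A H.
  - assert (HV : lnf false G (Var i) A) by (inversion H; subst; assumption).
    inversion HV; subst. now constructor.
  - inversion H as [| |? ? ? H'| |]; subst; [inversion H'|]. constructor; eauto.
  - assert (HV : lnf false G (App M N) A) by (inversion H; subst; assumption).
    inversion HV; subst. econstructor; eauto.
  - inversion H as [| |? ? ? H'| |? ? ? As C HNs HM _ _]; subst; [inversion H'|].
    econstructor; [|eauto]. clear -IHNs HNs.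
    induction HNs; constructor; inversion IHNs; subst; eauto.
Qed.

(** * Normalization by evaluation *)

(* [Box A] is interpreted as [A]: boxing is invisible to the value and is
   recovered from the type by [reify].  In the syntax [tm] of results the explicit
   substitution M[N1,...,Nn/x1,...,xn] becomes box(M{unbox Ni/xi}), which makes
   permutations and kappa steps identities.  Variables are de Bruijn levels. *)
Inductive tm : Type :=
| TVar (l : nat)
| TLam (t : tm)
| TApp (t u : tm)
| TBox (t : tm)
| TUnbox (t : tm).

Fixpoint nm (A : ty) : Type :=
  match A with
  | Atom _ => nat -> tm
  | Arr A B => nm A -> nm B
  | Box A => nm A
  end.

Fixpoint reify (A : ty) : nm A -> nat -> tm :=
  match A with
  | Atom _ => fun x => x
  | Arr A B => fun f k => TLam (reify B (f (reflect A (fun _ => TVar k))) (S k))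
  | Box A => fun x k => TBox (reify A x k)
  end
with reflect (A : ty) : (nat -> tm) -> nm A :=
  match A with
  | Atom _ => fun t => t
  | Arr A B => fun t x => reflect B (fun k => TApp (t k) (reify A x k))
  | Box A => fun t => reflect A (fun k => TUnbox (t k))
  end.

(** With [strict] false the cost conditions are vacuous and [ord] reduces to equality, so the
    decrease theorem becomes invariance under reduction. *)
Definition nbe_model : model.
Proof.
  refine {| carrier := nm; le := fun A => @eq (nm A); cost := fun _ _ => 0; strict := False;
            dflt := fun A => reflect A (fun _ => TVar 0);
            charge := fun A x => x; lam := fun A B f => f; app := fun A B p x => p x;
            esub := fun A n x => x; val := fun A x => x |};
    try (red; congruence); auto; intros; repeat split; auto; try tauto;
    repeat match goal with H : _ /\ _ |- _ => destruct H end; subst; auto; try tauto.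
  apply functional_extensionality. intros x. now apply H1.
Defined.

(** Environments depend on a level because an argument of an explicit substitution is read at the
    depth where its variable occurs, which affects the levels bound inside the argument. *)
Fixpoint tau (r : nat -> nat -> tm) (M : term) : nat -> tm :=
  match M with
  | Var i => r i
  | Abs _ M => fun k =>
      TLam (tau (fun i => match i with 0 => fun _ => TVar k | S j => r j end) M (S k))
  | App M N => fun k => TApp (tau r M k) (tau r N k)
  | Esub M Ns => fun k =>
      TBox (tau (fun i k => TUnbox (nth i (map (tau r) Ns) (fun _ => TVar 0) k)) M k)
  end.

Definition reflects (G : ctx) (e : env nbe_model) (r : nat -> nat -> tm) : Prop :=
  forall i A, nth_error G i = Some A -> e i A = reflect A (r i).

Lemma denb_nbe b M G e A : denb nbe_model b M G e A = den nbe_model M G e A.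
Proof. unfold denb, chg. now destruct (b && expandable M)%bool. Qed.

(** Neutral terms evaluate to reflected images and long normal forms reify to their images. The two
    claims meet at atoms, where [reify] and [reflect] are identities. *)
Lemma lnf_den_tau M : forall b G A e r,
  lnf b G M A -> reflects G e r ->
  if b then reify A (den nbe_model M G e A) = tau r M
  else den nbe_model M G e A = reflect A (tau r M).
Proof.
  induction M as [i|A0 M IH|M N IHM IHN|M Ns IHM IHNs] using term_nested_ind;
    intros b G A e r H Hr.
  - assert (HV : lnf false G (Var i) A) by (inversion H; subst; assumption).
    assert (HE : den nbe_model (Var i) G e A = reflect A (tau r (Var i)))
      by (inversion HV; subst; simpl; auto).
    destruct b; [|exact HE]. inversion H; subst. exact HE.
  - inversion H as [| |? ? ? H'|? ? ? B HM|]; subst; [inversion H'|].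
    apply functional_extensionality. intros k. simpl. f_equal.
    specialize (IH true (A0 :: G) B (ext nbe_model (A := A0) (reflect A0 (fun _ => TVar k)) e)
      (fun i => match i with 0 => fun _ => TVar k | S j => r j end) HM).
    simpl in IH. rewrite <- IH; [unfold chg; now destruct (true && expandable M)%bool|].
    intros [|i] T HT; simpl in *; [|now apply Hr]. injection HT as <-. apply (coerce_id nbe_model).
  - assert (HV : lnf false G (App M N) A) by (inversion H; subst; assumption).
    assert (HE : den nbe_model (App M N) G e A = reflect A (tau r (App M N))).
    { inversion HV as [|? ? ? A1 ? HM HN| | |]; subst.
      rewrite (den_App _ _ _ _ _ _ _ (lnf_typing _ _ _ _ HN)), denb_nbe.
      pose proof (IHM _ _ _ _ _ HM Hr) as E1. pose proof (IHN _ _ _ _ _ HN Hr) as E2.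
      simpl in *. rewrite E1. now rewrite E2. }
    destruct b; [|exact HE]. inversion H; subst. exact HE.
  - inversion H as [| |? ? ? H'| |? ? ? As C HNs HM _ _]; subst; [inversion H'|].
    assert (HTs : Forall2 (fun N A => typing G N (Box A)) Ns As).
    { clear -HNs. induction HNs; constructor; eauto using lnf_typing. }
    rewrite (den_Esub _ _ _ _ _ _ _ HTs), denb_nbe.
    apply functional_extensionality. intros k. simpl. f_equal.
    pose proof (IHM true As C (args_env nbe_model Ns G e)
      (fun i k => TUnbox (nth i (map (tau r) Ns) (fun _ => TVar 0) k)) HM) as E.
    simpl in E. rewrite <- E; [reflexivity|].
    intros i A HA. destruct (Forall2_nth_error_r _ _ _ _ _ HNs HA) as (N & HN & HL).
    rewrite (args_env_nth _ _ _ _ _ _ _ HN).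
    eapply Forall_forall in IHNs; [|eapply nth_error_In; eassumption].
    rewrite (nth_error_nth _ _ _ (map_nth_error (tau r) _ _ HN)).
    exact (IHNs false G (Box A) e r HL Hr).
Qed.

(** * Recovering a normal form from its image *)

Lemma typing_FV M : forall G A i, typing G M A -> In i (FV M) -> i < length G.
Proof.
  induction M as [j|A0 M IH|M N IHM IHN|M Ns IHM IHNs] using term_nested_ind;
    intros G A i HT Hi; inversion HT as [| | |? ? ? As C HNs HM]; subst.
  - destruct Hi as [<-|[]]. eapply nth_error_some_lt; eassumption.
  - apply in_FV_Abs in Hi. eapply IH in Hi; [|eassumption]. simpl in Hi. lia.
  - simpl in Hi. apply in_app_or in Hi as []; eauto.
  - apply in_FV_Esub in Hi as (N & HN & Hi).
    eapply Forall_forall in IHNs; [|eassumption].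
    apply In_nth_error in HN as [j HN].
    destruct (Forall2_nth_error_l _ _ _ _ _ HNs HN) as (B & _ & HB). eauto.
Qed.

Lemma le_of_left_inverse n m (f g : nat -> nat) :
  (forall a, a < n -> f a < m /\ g (f a) = a) -> n <= m.
Proof.
  intros H. rewrite <- (length_seq n 0), <- (length_seq m 0), <- (length_map g (seq 0 m)).
  apply NoDup_incl_length; [apply seq_NoDup|].
  intros a Ha. apply in_seq in Ha. destruct (H a) as [H1 H2]; [lia|].
  rewrite <- H2. apply in_map, in_seq. lia.
Qed.

Lemma teq_esub_permuted M M' Ns Ns' f g :
  length Ns' = length Ns ->
  (forall a, a < length Ns -> f a < length Ns /\ g (f a) = a) ->
  (forall b, b < length Ns -> g b < length Ns /\ f (g b) = b) ->
  (forall a, length Ns <= a -> f a = a) ->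
  teq (rename f M) M' ->
  (forall b N N', nth_error Ns (g b) = Some N -> nth_error Ns' b = Some N' -> teq N N') ->
  teq (Esub M Ns) (Esub M' Ns').
Proof.
  intros HL Hf Hg Hid HM HN.
  set (Ls := map (fun b => nth (g b) Ns (Var 0)) (seq 0 (length Ns))).
  assert (HLs : forall b, b < length Ns -> nth_error Ls b = nth_error Ns (g b)).
  { intros b Hb. unfold Ls.
    rewrite (map_nth_error _ _ _ (nth_error_nth' (seq 0 (length Ns)) 0 (n := b)
               ltac:(now rewrite length_seq))).
    rewrite seq_nth by assumption. symmetry. apply nth_error_nth'. now apply Hg. }
  eapply rst_trans.
  - apply rst_step. refine (Closure _ _ Hole _ _ I (Permute_pairs f M Ns Ls _ _ _ _ _)).
    + unfold Ls. now rewrite length_map, length_seq.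
    + intros; now apply Hf.
    + intros i j Hi Hj E. destruct (Hf i Hi) as [_ <-], (Hf j Hj) as [_ <-]. congruence.
    + assumption.
    + intros i Hi. destruct (Hf i Hi). rewrite HLs by assumption. congruence.
  - apply teq_esub; [assumption|]. apply Forall2_of_nth_error.
    + unfold Ls. now rewrite length_map, length_seq.
    + intros b N N' H1 H2. rewrite HLs in H1; [eauto|].
      apply nth_error_some_lt in H2. lia.
Qed.

(** Such images can be confused neither with an application nor with a level bound later, which is
    at least [K]. *)
Definition head_env (K : nat) (G : ctx) (r : nat -> nat -> tm) : Prop :=
  forall i B k, nth_error G i = Some B ->
    (exists l, l < K /\ r i k = TVar l) \/ (exists t, r i k = TUnbox t).

(** All levels from [K] on are quantified over because occurrences of one variable are compared at
    different depths. *)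
Definition matched (K : nat) (G G' : ctx) (r r' : nat -> nat -> tm) (f g : nat -> nat) : Prop :=
  forall i j B B' k, K <= k -> nth_error G i = Some B -> nth_error G' j = Some B' ->
    r i k = r' j k -> j = f i /\ i = g j /\ B = B'.

(** Carried through the induction to give every pair of an explicit substitution a partner: its
    variable occurs in the body, hence has a counterpart in the other body. *)
Definition occurs_in (K : nat) (r r' : nat -> nat -> tm) (M M' : term) : Prop :=
  forall i, In i (FV M) -> exists j k, In j (FV M') /\ K <= k /\ r i k = r' j k.

Definition tau_args (r : nat -> nat -> tm) (Ns : list term) : nat -> nat -> tm :=
  fun i k => TUnbox (nth i (map (tau r) Ns) (fun _ => TVar 0) k).

Lemma tau_args_nth r Ns i N k : nth_error Ns i = Some N -> tau_args r Ns i k = TUnbox (tau r N k).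
Proof.
  intros H. unfold tau_args.
  now rewrite (nth_error_nth _ _ _ (map_nth_error (tau r) _ _ H)).
Qed.

(* Two normal forms with the same image correspond under the matching of their
   variables by equality of images, whatever the level [k]; for an explicit
   substitution this matching of the bound variables is the permutation of the
   pairs. *)
Lemma tau_injective M : forall b G G' M' A A' r r' f g K k,
  lnf b G M A -> lnf b G' M' A' -> (b = true -> A = A') ->
  head_env K G r -> head_env K G' r' -> matched K G G' r r' f g ->
  K <= k -> tau r M k = tau r' M' k ->
  A = A' /\ teq (rename f M) M' /\ teq (rename g M') M /\
  occurs_in K r r' M M' /\ occurs_in K r' r M' M.
Proof.
  induction M as [i|A0 M IH|M N IHM IHN|M Ns IHM IHNs] using term_nested_ind;
    intros b G G' M' A A' r r' f g K k HM HM' HA Hr Hr' Hm Hk E.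
  - assert (HV : lnf false G (Var i) A) by (inversion HM; subst; assumption).
    assert (HV' : lnf false G' M' A').
    { destruct b; [|assumption]. specialize (HA eq_refl). subst A'.
      inversion HM; subst. inversion HM'; subst. assumption. }
    inversion HV as [? ? ? Hi| | | |]; subst.
    inversion HV' as [? j ? Hj|? P Q| | |]; subst.
    + simpl in E. destruct (Hm _ _ _ _ _ Hk Hi Hj E) as (-> & Hg & <-).
      split; [reflexivity|]. split; [apply rst_refl|].
      split; [simpl; rewrite <- Hg; apply rst_refl|].
      split; intros l [<-|[]]; simpl; eauto 10.
    + simpl in E. destruct (Hr i A k Hi) as [(l & _ & El)|(t & El)]; congruence.
  - inversion HM as [| |? ? ? H'|? ? ? B HB|]; subst; [inversion H'|].
    specialize (HA eq_refl). subst A'.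
    inversion HM' as [| | |? ? M1 ? HB'|]; subst. simpl in E. injection E as E.
    set (r1 := fun i => match i with 0 => fun _ => TVar k | S j => r j end) in E.
    set (r1' := fun i => match i with 0 => fun _ => TVar k | S j => r' j end) in E.
    assert (Hx : forall (q : nat -> nat -> tm) H, head_env K H q -> head_env (S k) (A0 :: H)
                   (fun i => match i with 0 => fun _ => TVar k | S j => q j end)).
    { intros q H Hq [|i] C k' HC; simpl in *; [left; exists k; auto|].
      destruct (Hq i C k' HC) as [(l & Hl & El)|Ht]; [left; exists l; split; [lia|]|]; auto. }
    (* The new level satisfies [K <= k], while the variable images that are levels lie below [K]. *)
    assert (Hfresh : forall (q : nat -> nat -> tm) H i C k', head_env K H q ->
              nth_error H i = Some C -> q i k' <> TVar k).
    { intros q H i C k' Hq HC E'. destruct (Hq i C k' HC) as [(l & Hl & El)|(t & El)];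
        [|congruence]. assert (l = k) by congruence. lia. }
    assert (Hm1 : matched (S k) (A0 :: G) (A0 :: G') r1 r1' (up_ren f) (up_ren g)).
    { intros [|i] [|j] C C' k' Hk' HC HC' Eij; simpl in *.
      - repeat split; congruence.
      - symmetry in Eij. now apply Hfresh with (1 := Hr') (2 := HC') in Eij.
      - now apply Hfresh with (1 := Hr) (2 := HC) in Eij.
      - destruct (Hm i j C C' k') as (-> & <- & ->); auto. lia. }
    destruct (IH _ _ _ _ _ _ _ _ _ _ _ _ HB HB' (fun _ => eq_refl) (Hx _ _ Hr) (Hx _ _ Hr')
                Hm1 (le_n _) E) as (_ & T1 & T2 & O1 & O2).
    split; [reflexivity|].
    split; [exact (teq_fill (HAbs A0 Hole) _ _ T1)|].
    split; [exact (teq_fill (HAbs A0 Hole) _ _ T2)|].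
    split; intros i Hi; apply in_FV_Abs in Hi.
    + destruct (O1 _ Hi) as ([|j] & k' & Hj & Hk' & Eij).
      * destruct (nth_error_lt _ _ (typing_FV _ _ _ _ (lnf_typing _ _ _ _ HB) Hi)) as [C HC].
        now apply Hfresh with (1 := Hr) (2 := HC) in Eij.
      * exists j, k'. rewrite in_FV_Abs. repeat split; auto. lia.
    + destruct (O2 _ Hi) as ([|j] & k' & Hj & Hk' & Eij).
      * destruct (nth_error_lt _ _ (typing_FV _ _ _ _ (lnf_typing _ _ _ _ HB') Hi)) as [C HC].
        now apply Hfresh with (1 := Hr') (2 := HC) in Eij.
      * exists j, k'. rewrite in_FV_Abs. repeat split; auto. lia.
  - assert (HV : lnf false G (App M N) A) by (inversion HM; subst; assumption).
    assert (HV' : lnf false G' M' A').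
    { destruct b; [|assumption]. specialize (HA eq_refl). subst A'.
      inversion HM; subst. inversion HM'; subst. assumption. }
    inversion HV as [|? ? ? A1 ? HP HQ| | |]; subst.
    inversion HV' as [? j ? Hj|? P Q A1' ? HP' HQ'| | |]; subst; simpl in E.
    + destruct (Hr' j A' k Hj) as [(l & _ & El)|(t & El)]; congruence.
    + injection E as E1 E2.
      destruct (IHM _ _ _ _ _ _ _ _ _ _ _ _ HP HP' ltac:(discriminate) Hr Hr' Hm Hk E1)
        as (ET & T1 & T2 & O1 & O2).
      (* Equal heads have equal types, so the arguments are compared at one known type, as flag true
         requires. *)
      injection ET as <- <-.
      destruct (IHN _ _ _ _ _ _ _ _ _ _ _ _ HQ HQ' (fun _ => eq_refl) Hr Hr' Hm Hk E2)
        as (_ & T3 & T4 & O3 & O4).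
      split; [reflexivity|]. split; [now apply teq_app|]. split; [now apply teq_app|].
      split; intros i Hi; simpl in Hi; apply in_app_or in Hi as [Hi|Hi];
        [apply O1 in Hi|apply O3 in Hi|apply O2 in Hi|apply O4 in Hi];
        destruct Hi as (j & k' & Hj & Hk'); exists j, k'; simpl; auto using in_or_app.
  - inversion HM as [| |? ? ? H'| |? ? ? As C HNs HB Hu Hd]; subst; [inversion H'|].
    specialize (HA eq_refl). subst A'.
    inversion HM' as [| | | |? M1 Ns' As' ? HNs' HB' Hu' Hd']; subst.
    simpl in E. injection E as E. fold (tau_args r Ns) (tau_args r' Ns') in E.
    pose proof (Forall2_length HNs) as LN. pose proof (Forall2_length HNs') as LN'.
    (* Two pairs are partners when their arguments have equal images at some admissible level. The
       level is existential because it depends on the occurrence in the body. *)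
    set (T := fun a b' => exists N N' k', nth_error Ns a = Some N /\ nth_error Ns' b' = Some N' /\
                K <= k' /\ tau r N k' = tau r' N' k').
    assert (HT : forall a b' N N', T a b' -> nth_error Ns a = Some N -> nth_error Ns' b' = Some N' ->
       nth_error As a = nth_error As' b' /\ teq (rename f N) N' /\ teq (rename g N') N /\
       occurs_in K r r' N N' /\ occurs_in K r' r N' N).
    { intros a b' N N' (P & P' & k' & HP & HP' & Hk' & EP) HN HN'.
      assert (P = N) as -> by congruence. assert (P' = N') as -> by congruence.
      destruct (Forall2_nth_error_l _ _ _ _ _ HNs HN) as (B & HAB & HB0).
      destruct (Forall2_nth_error_l _ _ _ _ _ HNs' HN') as (B' & HAB' & HB0').
      eapply Forall_forall in IHNs; [|eapply nth_error_In; eassumption].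
      destruct (IHNs _ _ _ _ _ _ _ _ _ _ _ _ HB0 HB0' ltac:(discriminate) Hr Hr' Hm Hk' EP)
        as (ET & HR). split; [congruence|exact HR]. }
    (* Two partners of one pair would be equal modulo [teq], which the last premise of [lnf_esub]
       forbids. *)
    assert (Tr : forall a b1 b2, T a b1 -> T a b2 -> b1 = b2).
    { intros a b1 b2 H1 H2. assert (H1' := H1). assert (H2' := H2).
      destruct H1' as (P & P1 & _ & HP & HP1 & _), H2' as (P' & P2 & _ & HP' & HP2 & _).
      assert (P' = P) as -> by congruence.
      destruct (HT _ _ _ _ H1 HP HP1) as (_ & Q1 & _), (HT _ _ _ _ H2 HP HP2) as (_ & Q2 & _).
      eapply Hd'; [eassumption..|]. eapply rst_trans; [apply rst_sym|]; eassumption. }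
    assert (Tl : forall a1 a2 b', T a1 b' -> T a2 b' -> a1 = a2).
    { intros a1 a2 b' H1 H2. assert (H1' := H1). assert (H2' := H2).
      destruct H1' as (P1 & P & _ & HP1 & HP & _), H2' as (P2 & P' & _ & HP2 & HP' & _).
      assert (P' = P) as -> by congruence.
      destruct (HT _ _ _ _ H1 HP1 HP) as (_ & _ & Q1 & _),
        (HT _ _ _ _ H2 HP2 HP) as (_ & _ & Q2 & _).
      eapply Hd; [eassumption..|]. eapply rst_trans; [apply rst_sym|]; eassumption. }
    assert (Tlt : forall a b', T a b' -> a < length Ns /\ b' < length Ns').
    { intros a b' (P & P' & _ & HP & HP' & _).
      split; eapply nth_error_some_lt; eassumption. }
    (* Partnership is only a relation, so the renaming is obtained by choice; beyond the list it
       must fix indices, as [permute_pairs] requires. *)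
    set (f1 := fun a => if a <? length Ns then epsilon (inhabits 0) (T a) else a).
    set (g1 := fun b' => if b' <? length Ns' then epsilon (inhabits 0) (fun a => T a b') else b').
    assert (Hf1 : forall a b', T a b' -> b' = f1 a /\ a = g1 b').
    { intros a b' H. destruct (Tlt _ _ H) as [L1 L2]. unfold f1, g1.
      destruct (Nat.ltb_spec a (length Ns)); [|lia].
      destruct (Nat.ltb_spec b' (length Ns')); [|lia]. split.
      - apply Tr with a; [assumption|]. apply epsilon_spec; eauto.
      - apply Tl with b'; [assumption|].
        apply (epsilon_spec (inhabits 0) (fun a => T a b')); eauto. }
    assert (HTau : forall a b' k', a < length Ns -> b' < length Ns' -> K <= k' ->
              tau_args r Ns a k' = tau_args r' Ns' b' k' -> T a b').
    { intros a b' k' La Lb Hk' Eab.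
      destruct (nth_error_lt _ _ La) as [P HP], (nth_error_lt _ _ Lb) as [P' HP'].
      rewrite (tau_args_nth _ _ _ _ _ HP), (tau_args_nth _ _ _ _ _ HP') in Eab.
      injection Eab as Eab. exists P, P', k'. auto. }
    assert (Hm1 : matched K As As' (tau_args r Ns) (tau_args r' Ns') f1 g1).
    { intros a b' B B' k' Hk' HB1 HB2 Eab.
      apply nth_error_some_lt in HB1 as La. apply nth_error_some_lt in HB2 as Lb.
      rewrite <- LN in La. rewrite <- LN' in Lb.
      pose proof (HTau _ _ _ La Lb Hk' Eab) as HTab.
      destruct (Hf1 _ _ HTab) as [H1 H2]. repeat split; auto.
      destruct (nth_error_lt _ _ La) as [P HP], (nth_error_lt _ _ Lb) as [P' HP'].
      destruct (HT _ _ _ _ HTab HP HP') as [ET _]. congruence. }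
    assert (Hx : forall q Ls Bs, head_env K Bs (tau_args q Ls)).
    { intros q Ls Bs i B k' _. right. unfold tau_args. eauto. }
    destruct (IHM _ _ _ _ _ _ _ _ _ _ _ _ HB HB' (fun _ => eq_refl) (Hx r Ns As)
                (Hx r' Ns' As') Hm1 Hk E) as (_ & T1 & T2 & O1 & O2).
    (* Totality comes from the body: variable [a] occurs in it, and its counterpart there is the
       partner. *)
    assert (Tf : forall a, a < length Ns -> T a (f1 a)).
    { intros a La. destruct (O1 a (Hu a La)) as (b' & k' & Hb' & Hk' & Eab).
      apply typing_FV with (1 := lnf_typing _ _ _ _ HB') in Hb'. rewrite <- LN' in Hb'.
      pose proof (HTau _ _ _ La Hb' Hk' Eab) as HTab.
      destruct (Hf1 _ _ HTab) as [<- _]. assumption. }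
    assert (Tg : forall b', b' < length Ns' -> T (g1 b') b').
    { intros b' Lb. destruct (O2 b' (Hu' b' Lb)) as (a & k' & Ha & Hk' & Eab).
      apply typing_FV with (1 := lnf_typing _ _ _ _ HB) in Ha. rewrite <- LN in Ha.
      symmetry in Eab. pose proof (HTau _ _ _ Ha Lb Hk' Eab) as HTab.
      destruct (Hf1 _ _ HTab) as [_ <-]. assumption. }
    assert (Ff : forall a, a < length Ns -> f1 a < length Ns' /\ g1 (f1 a) = a).
    { intros a La. specialize (Tf a La). split; [apply (Tlt _ _ Tf)|].
      symmetry. now apply Hf1. }
    assert (Fg : forall b', b' < length Ns' -> g1 b' < length Ns /\ f1 (g1 b') = b').
    { intros b' Lb. specialize (Tg b' Lb). split; [apply (Tlt _ _ Tg)|].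
      symmetry. now apply Hf1. }
    assert (LE : length Ns' = length Ns).
    { apply Nat.le_antisymm; eapply le_of_left_inverse; eassumption. }
    split; [reflexivity|]. repeat split.
    (* The outer renaming [f] reaches only the arguments, while [f1] permutes the variables of the
       body. *)
    + apply (teq_esub_permuted M M1 (map (rename f) Ns) Ns' f1 g1); rewrite ?length_map.
      * assumption.
      * intros a La. rewrite <- LE. now apply Ff.
      * intros a La. apply Fg. lia.
      * intros a La. unfold f1. destruct (Nat.ltb_spec a (length Ns)); [lia|reflexivity].
      * assumption.
      * intros b' N N' HN HN'. rewrite nth_error_map in HN.
        destruct (nth_error Ns (g1 b')) as [P|] eqn:HP; [|discriminate]. injection HN as <-.
        apply nth_error_some_lt in HN' as Lb.
        apply (HT _ _ _ _ (Tg _ Lb) HP HN').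
    + apply (teq_esub_permuted M1 M (map (rename g) Ns') Ns g1 f1); rewrite ?length_map.
      * auto.
      * intros a La. rewrite LE. now apply Fg.
      * intros a La. apply Ff. lia.
      * intros a La. unfold g1. destruct (Nat.ltb_spec a (length Ns')); [lia|reflexivity].
      * assumption.
      * intros a N N' HN HN'. rewrite nth_error_map in HN.
        destruct (nth_error Ns' (f1 a)) as [P|] eqn:HP; [|discriminate]. injection HN as <-.
        apply nth_error_some_lt in HN' as La.
        apply (HT _ _ _ _ (Tf _ La) HN' HP).
    + intros i Hi. apply in_FV_Esub in Hi as (N & HN & Hi).
      apply In_nth_error in HN as [a HN]. apply nth_error_some_lt in HN as La.
      destruct (nth_error_lt _ _ (proj1 (Ff _ La))) as [N' HN'].
      destruct (HT _ _ _ _ (Tf _ La) HN HN') as (_ & _ & _ & O & _).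
      destruct (O i Hi) as (j & k' & Hj & Hk'). exists j, k'.
      split; [|assumption]. apply in_FV_Esub. eauto using nth_error_In.
    + intros i Hi. apply in_FV_Esub in Hi as (N' & HN' & Hi).
      apply In_nth_error in HN' as [b' HN']. apply nth_error_some_lt in HN' as Lb.
      destruct (nth_error_lt _ _ (proj1 (Fg _ Lb))) as [N HN].
      destruct (HT _ _ _ _ (Tg _ Lb) HN HN') as (_ & _ & _ & _ & O).
      destruct (O i Hi) as (j & k' & Hj & Hk'). exists j, k'.
      split; [|assumption]. apply in_FV_Esub. eauto using nth_error_In.
Qed.

(** * Confluence *)

(** Free indices serve directly as levels below [length G]; reading back starts at [length G], so
    levels bound by abstractions are fresh. *)
Definition id_env : env nbe_model := fun i A => reflect A (fun _ => TVar i).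

Lemma lnf_teq_of_den G A M N :
  lnf true G M A -> lnf true G N A ->
  den nbe_model M G id_env A = den nbe_model N G id_env A -> teq M N.
Proof.
  intros HM HN E.
  set (r := fun i (_ : nat) => TVar i).
  assert (Hr : reflects G id_env r) by (intros i B _; reflexivity).
  pose proof (lnf_den_tau _ _ _ _ _ _ HM Hr) as EM.
  pose proof (lnf_den_tau _ _ _ _ _ _ HN Hr) as EN. cbn beta iota in EM, EN.
  assert (Hh : head_env (length G) G r).
  { intros i B k Hi. left. exists i. split; [|reflexivity].
    eapply nth_error_some_lt; eassumption. }
  destruct (tau_injective M true G G N A A r r (fun i => i) (fun i => i) (length G) (length G))
    as (_ & HT & _); auto.
  - intros i j B B' k _ HB HB' Eij. injection Eij as <-. repeat split. congruence.
  - rewrite <- EM, <- EN, E. reflexivity.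
  - now rewrite rename_id in HT.
Qed.

Lemma Lambda_step_den G (x y : Lambda G) A :
  union _ (Lambda_eq G) (Lambda_red G) x y -> typing G (proj1_sig x) A ->
  typing G (proj1_sig y) A /\
  den nbe_model (proj1_sig y) G id_env A = den nbe_model (proj1_sig x) G id_env A.
Proof.
  assert (Hr : le_env nbe_model G id_env id_env) by (intros i B _; reflexivity).
  intros [H|H] HT.
  - split; [eapply teq_typing; eassumption|].
    rewrite <- !(denb_nbe true). now apply (teq_den_le nbe_model).
  - destruct (Lambda_red_decreases nbe_model _ _ _ _ _ H HT Hr) as [HT' [E _]].
    split; [assumption|]. rewrite <- !(denb_nbe true). exact E.
Qed.

Lemma Lambda_steps_den G (x y : Lambda G) A :
  clos_refl_trans _ (union _ (Lambda_eq G) (Lambda_red G)) x y -> typing G (proj1_sig x) A ->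
  typing G (proj1_sig y) A /\
  den nbe_model (proj1_sig y) G id_env A = den nbe_model (proj1_sig x) G id_env A.
Proof.
  induction 1 as [x y H|x|x y z _ IH1 _ IH2]; intros HT.
  - now apply Lambda_step_den.
  - auto.
  - destruct (IH1 HT) as [HT1 E1]. destruct (IH2 HT1) as [HT2 E2].
    split; [assumption|]. congruence.
Qed.

Lemma Lambda_normal_form G (x : Lambda G) :
  exists y, clos_refl_trans _ (union _ (Lambda_eq G) (Lambda_red G)) x y /\
    normal true G (proj1_sig y).
Proof.
  induction x as [x IH] using (well_founded_induction (well_founded_ltof _ (measure G))).
  destruct (classic (exists y, Lambda_red G x y)) as [[y Hy]|Hn].
  - destruct (IH y (Lambda_red_measure _ _ _ Hy)) as (z & Hz & Hnz).
    exists z. split; [|assumption]. eapply rt_trans; [apply rt_step; right|]; eassumption.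
  - exists x. split; [apply rt_refl|]. intros M' N HM HS.
    destruct (proj2_sig x) as [A HA].
    pose proof (teq_typing _ _ _ _ HM HA) as HT.
    pose proof (cstep_typing _ root_red_typing _ _ _ _ _ HS HT) as HTN.
    apply Hn. exists (exist _ N (ex_intro _ A HTN)). exists M', N.
    (* Here the structural rules must be no more generous than [red]: a step that witnesses
       non-normality has to be a genuine reduction. *)
    split; [assumption|]. split; [now apply cstep_red|apply rst_refl].
Qed.

Theorem theorem3p14 (G : ctx) :
  strongly_normalizing (Lambda_red G) /\
  confluent_modulo (Lambda_eq G) (Lambda_red G).
Proof.
  split; [apply Lambda_red_strongly_normalizing|].
  intros x y z Hy Hz. destruct (proj2_sig x) as [A HA].
  destruct (Lambda_normal_form G y) as (y' & Hy' & Ny).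
  destruct (Lambda_normal_form G z) as (z' & Hz' & Nz).
  destruct (Lambda_steps_den G x y' A) as [Ty Ey];
    [exact (rt_trans _ _ _ _ _ Hy Hy')|assumption|].
  destruct (Lambda_steps_den G x z' A) as [Tz Ez];
    [exact (rt_trans _ _ _ _ _ Hz Hz')|assumption|].
  exists y'. split; [assumption|].
  (* Both normal forms have the denotation of [x], so the diagram closes with an equality step. *)
  eapply rt_trans; [exact Hz'|]. apply rt_step. left.
  apply (lnf_teq_of_den G A); [apply normal_lnf; auto; discriminate|apply normal_lnf; auto; discriminate|congruence].
Qed.
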